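(* Let $(A_{-1}\oplus A_0;\rho,l_1,l_2,l_3)$ be a transitive Lie 2-algebroid over a manifold $M$, let $\mathcal G=\ker\rho$ and let $\mathfrak G=(A_{-1}\oplus\mathcal G;\mathfrak l_1,\mathfrak l_2,\mathfrak l_3)$ be the corresponding graded bundle of Lie 2-algebras. Choose a splitting $(\sigma,\gamma)$, with associated $\nabla^0,\nabla^1,R_\gamma,I_\gamma,J,K$. Define $F^1:TM\to\mathrm{DER}^0(\mathfrak G)$, $F^2:\wedge^2TM\to\mathrm{DER}^{-1}(\mathfrak G)$, $F^3:\wedge^3TM\to\mathrm{DER}^{-2}(\mathfrak G)$ by $$F^1(X)=(\nabla^0_X,\nabla^1_X,K(X,\cdot,\cdot)),\quad F^2(X,Y)=J(X,Y,\cdot)+R_\gamma(X,Y),\quad F^3(X,Y,Z)=I_\gamma(X,Y,Z).$$ Then $(F^1,F^2,F^3)$ is a morphism from the tangent Lie algebroid $TM$ to the strict Lie 3-algebroid $\mathrm{DER}(\mathfrak G)$.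
   Context: A Lie 2-algebra $(V_{-1}\oplus V_0;l_1,l_2,l_3)$: linear $l_1:V_{-1}\to V_0$; bilinear $l_2$, skew-symmetric on $V_0$ with values in $V_0$, $l_2(x,m)=-l_2(m,x)\in V_{-1}$, zero on $V_{-1}\times V_{-1}$; totally skew-symmetric $l_3:V_0^3\to V_{-1}$; such that for $w,x,y,z\in V_0$, $m,n\in V_{-1}$: $l_1l_2(x,m)=l_2(x,l_1m)$; $l_2(l_1m,n)=l_2(m,l_1n)$; $l_1l_3(x,y,z)=l_2(x,l_2(y,z))-l_2(l_2(x,y),z)-l_2(y,l_2(x,z))$; $l_3(x,y,l_1m)=l_2(x,l_2(y,m))-l_2(l_2(x,y),m)-l_2(y,l_2(x,m))$; $l_2(w,l_3(x,y,z))-l_2(x,l_3(w,y,z))+l_2(y,l_3(w,x,z))+l_2(l_3(w,x,y),z)-l_3(l_2(w,x),y,z)-l_3(x,l_2(w,y),z)-l_3(x,y,l_2(w,z))+l_3(w,l_2(x,y),z)+l_3(w,y,l_2(x,z))-l_3(w,x,l_2(y,z))=0$. A Lie 2-algebroid over $M$: graded vector bundle $A_{-1}\oplus A_0$, bundle map $\rho:A_0\to TM$, brackets making $(\Gamma(A_{-1})\oplus\Gamma(A_0);l_1,l_2,l_3)$ a Lie 2-algebra, with $l_1,l_3$ $C^\infty(M)$-linear and $l_2(X^0,fY)=fl_2(X^0,Y)+\rho(X^0)(f)Y$ for $X^0\in\Gamma(A_0)$ and $Y$ a section of $A_0$ or $A_{-1}$. It is transitive if $\rho$ is surjective. Then,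 with $\mathcal G=\ker\rho$, restricting the brackets gives a graded bundle of Lie 2-algebras (bundle with $C^\infty(M)$-multilinear Lie 2-algebra brackets) $(A_{-1}\oplus\mathcal G;\mathfrak l_1,\mathfrak l_2,\mathfrak l_3)$. A splitting is a pair: a bundle map $\sigma:TM\to A_0$ with $\rho\circ\sigma=\mathrm{id}$ and a bundle map $\gamma:\wedge^2TM\to A_{-1}$. It defines: $\nabla^0_Xu=l_2(\sigma(X),u)$, $\nabla^1_Xm=l_2(\sigma(X),m)$, $R(X,Y)=\sigma[X,Y]-l_2(\sigma(X),\sigma(Y))-\mathfrak l_1\gamma(X,Y)$, $I(X,Y,Z)=-d_{\nabla^1}\gamma(X,Y,Z)-l_3(\sigma(X),\sigma(Y),\sigma(Z))$, $J(X,Y,u)=-l_3(\sigma(X),\sigma(Y),u)$, $K(X,u,v)=l_3(\sigma(X),u,v)$ ($X,Y,Z\in\mathfrak X(M)$, $u,v\in\Gamma(\mathcal G)$, $m\in\Gamma(A_{-1})$), and $R_\gamma=R+\mathfrak l_1\circ\gamma$, $I_\gamma=I+d_{\nabla^1}\gamma$, where $d_\nabla\theta(X_1,\dots,X_{k+1})=\sum_i(-1)^{i+1}\nabla_{X_i}\theta(\dots,\widehat{X_i},\dots)+\sum_{i<j}(-1)^{i+j}\theta([X_i,X_j],\dots,\widehat{X_i},\dots,\widehat{X_j},\dots)$. A strict Lie 3-algebroid $(A'_{-2}\oplus A'_{-1}\oplus A'_0;\rho',l_1',l_2')$: graded vector bundle with bundle map $\rho':A'_0\to TM$, $C^\infty(M)$-linear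 differential $l_1'$ of degree $1$ and graded skew-symmetric bracket $l_2'$ of degree 0 on sections forming a differential graded Lie algebra, with $l_2'(X^0,fY)=fl_2'(X^0,Y)+\rho'(X^0)(f)Y$ for $X^0$ of degree 0. A morphism from a Lie algebroid $(A;\rho,l_2)$ to such a strict Lie 3-algebroid consists of bundle maps $F^1:A\to A_0'$, $F^2:\wedge^2A\to A'_{-1}$, $F^3:\wedge^3A\to A'_{-2}$ such that $\rho'\circ F^1=\rho$; $F^1l_2(X,Y)-l_2'(F^1X,F^1Y)=l_1'F^2(X,Y)$; $l_2'(F^1(X),F^2(Y,Z))-F^2(l_2(X,Y),Z)+c.p.=l_1'F^3(X,Y,Z)$ ($c.p.$: cyclic permutations of $X,Y,Z$); and $\sum_{i=1}^4(-1)^{i+1}l_2'(F^1(X_i),F^3(X_1,\dots,\widehat{X_i},\dots,X_4))+\sum_{i<j}(-1)^{i+j}\big(F^3(l_2(X_i,X_j),X_k,X_l)-\tfrac12l_2'(F^2(X_i,X_j),F^2(X_k,X_l))\big)=0$, where $k<l$ and $\{k,l\}\cap\{i,j\}=\emptyset$. The tangent Lie algebroid $TM$ has identity anchor and the Lie bracket of vector fields. The strict Lie 3-algebroid $\mathrm{DER}(\mathfrak G)$, for $\mathfrak G=(\mathcal G_{-1}\oplus\mathcal G_0;\mathfrak l_1,\mathfrak l_2,\mathfrak l_3)$ (here $\mathcal G_{-1}=A_{-1}$, $\mathcal G_0=\mathcal G$): For a vector bundle $E$, $\mathfrak D(E)$ is the bundle of covariant differential operators (sections: $\mathbb R$-linear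 $D$ on $\Gamma(E)$ with $D(fe)=fD(e)+(\text{symbol of }D)(f)e$, the symbol being a vector field); $\mathbb j_0,\mathbb j_1$ are the symbol maps of $\mathfrak D(\mathcal G_0),\mathfrak D(\mathcal G_{-1})$. A degree 0 derivation is $\mathfrak d=(\mathfrak d_0,\mathfrak d_1,l_{\mathfrak d})$, $\mathfrak d_0\in\Gamma(\mathfrak D(\mathcal G_0))$, $\mathfrak d_1\in\Gamma(\mathfrak D(\mathcal G_{-1}))$, $l_{\mathfrak d}\in\Gamma(\mathrm{Hom}(\wedge^2\mathcal G_0,\mathcal G_{-1}))$ with $\mathbb j_0(\mathfrak d_0)=\mathbb j_1(\mathfrak d_1)$, $\mathfrak d_0\mathfrak l_1=\mathfrak l_1\mathfrak d_1$, $\mathfrak d_0\mathfrak l_2(u,v)=\mathfrak l_2(\mathfrak d_0u,v)+\mathfrak l_2(u,\mathfrak d_0v)+\mathfrak l_1l_{\mathfrak d}(u,v)$, $\mathfrak d_1\mathfrak l_2(u,m)=\mathfrak l_2(\mathfrak d_0u,m)+\mathfrak l_2(u,\mathfrak d_1m)+l_{\mathfrak d}(u,\mathfrak l_1m)$, and $l_{\mathfrak d}(u,\mathfrak l_2(v,w))+\mathfrak l_2(u,l_{\mathfrak d}(v,w))+\mathfrak l_3(\mathfrak d_0u,v,w)+\mathfrak l_3(u,\mathfrak d_0v,w)+\mathfrak l_3(u,v,\mathfrak d_0w)=\mathfrak d_1\mathfrak l_3(u,v,w)+l_{\mathfrak d}(\mathfrak l_2(u,v),w)+l_{\mathfrak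 d}(v,\mathfrak l_2(u,w))+\mathfrak l_2(l_{\mathfrak d}(u,v),w)+\mathfrak l_2(v,l_{\mathfrak d}(u,w))$. These are the sections of $\mathrm{DER}^0(\mathfrak G)$ (regarded as a vector bundle); $\mathrm{DER}^{-1}(\mathfrak G)=\mathrm{Hom}(\mathcal G_0,\mathcal G_{-1})\oplus\mathcal G_0$; $\mathrm{DER}^{-2}(\mathfrak G)=\mathcal G_{-1}$. Anchor: $\mathbb j(\mathfrak d)=\mathbb j_0(\mathfrak d_0)$. Differential: $\mathrm d(m)=-\mathfrak l_2(m,\cdot)+\mathfrak l_1(m)$; $\mathrm d(\phi+u)=(\mathfrak l_1\circ\phi,\phi\circ\mathfrak l_1,l_{\delta(\phi)})+(\mathfrak l_2(u,\cdot),\mathfrak l_2(u,\cdot),\mathfrak l_3(u,\cdot,\cdot))$ with $l_{\delta(\phi)}(u,v)=\phi(\mathfrak l_2(u,v))-\mathfrak l_2(\phi(u),v)-\mathfrak l_2(u,\phi(v))$. Brackets: $[\mathfrak d,\mathfrak t]_{\mathrm{DER}}=([\mathfrak d_0,\mathfrak t_0],[\mathfrak d_1,\mathfrak t_1],l)$ (commutators) with $l(u,v)=\mathfrak d_1l_{\mathfrak t}(u,v)-l_{\mathfrak t}(\mathfrak d_0u,v)-l_{\mathfrak t}(u,\mathfrak d_0v)+l_{\mathfrak d}(\mathfrak t_0u,v)+l_{\mathfrak d}(u,\mathfrak t_0v)-\mathfrak t_1l_{\mathfrak d}(u,v)$; $[\mathfrak d,\phi+u]_{\mathrm{DER}}=\mathfrak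 d_1\circ\phi-\phi\circ\mathfrak d_0+l_{\mathfrak d}(u,\cdot)+\mathfrak d_0(u)$; $[\mathfrak d,m]_{\mathrm{DER}}=\mathfrak d_1(m)$; $[\phi+u,\psi+v]_{\mathrm{DER}}=\phi(v)+\psi(u)$; others by graded skew-symmetry or zero for degree reasons.
   Formalization: The definition of Lie 2-algebroid is taken to include C^∞(M)-linearity of l_2(x,m) in x∈Γ(A_0) for m∈Γ(A_{-1}) (anchor zero in degree -1); without it F^1 need not be a bundle map, e.g. A_0=TM, A_{-1} a trivial line bundle, l_1=l_3=0, l_2(X,m)=X(m)+div(X)m. *)

(* Defs.v *)
From HB Require Import structures.
From mathcomp Require Import all_boot all_order all_algebra.
From mathcomp Require Import mathcomp_extra boolp classical_sets functions cardinality.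
From mathcomp Require Import reals topology normedtype derive.

Set Implicit Arguments.
Unset Strict Implicit.
Unset Printing Implicit Defensive.
Import Order.TTheory GRing.Theory Num.Theory.
Import numFieldNormedType.Exports.
Local Open Scope classical_set_scope.
Local Open Scope ring_scope.

(* Vector bundles over a smooth manifold M are given by fibres and local
   trivializations, and enter the Lie structures through their modules of
   smooth sections over C^oo(M): a bundle map E -> F over the identity is a
   C^oo(M)-linear map of sections, a bundle map from an exterior power is an
   alternating C^oo(M)-multilinear map of sections.  Vector fields are the
   derivations of C^oo(M). *)

Section Euclidean.
Variables (R : realType) (n : nat).
Implicit Types (U V : set 'rV[R]_n) (f g : 'rV[R]_n -> R).

(* f is C^k on U (meant for open U): f and its iterated partial derivatives of
   order at most k exist and are continuous at every point of U. *)
Fixpoint Ck (k : nat) U f : Prop :=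
  (forall x, U x -> {for x, continuous f}) /\
  if k is k'.+1 then
    forall i : 'I_n, (forall x, U x -> derivable f x (delta_mx 0 i)) /\
                     Ck k' U ('D_(delta_mx 0 i) f)
  else True.

Definition smooth_on U f : Prop := forall k, Ck k U f.

Lemma Ck_cont k U f : Ck k U f -> forall x, U x -> {for x, continuous f}.
Proof. by case: k => [|k] []. Qed.

Lemma CkS k U f : Ck k.+1 U f -> Ck k U f.
Proof.
elim: k f => [|k IH] f; first by move=> [].
move=> [cf df]; split=> // i; have [df1 df2] := df i; split=> //.
exact: IH.
Qed.

Lemma Ck_sub k U V f : V `<=` U -> Ck k U f -> Ck k V f.
Proof.
move=> VU; elim: k f => [|k IH] f [cf df]; split=> //.
- by move=> x /VU; exact: cf.
- by move=> x /VU; exact: cf.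
- by move=> i; have [d1 d2] := df i; split; [move=> x /VU; exact: d1|exact: IH].
Qed.

Lemma Ck_ext k U f g : open U -> (forall x, U x -> f x = g x) ->
  Ck k U f -> Ck k U g.
Proof.
move=> oU; elim: k f g => [|k IH] f g fg [cf df].
all: have nfg x : U x -> {near x, f =1 g} by
  move=> Ux; near=> y; apply: fg; near: y; exact: open_nbhs_nbhs.
all: have cg x : U x -> {for x, continuous g} by
  move=> Ux; rewrite /prop_for /continuous_at -(fg x Ux);
  exact: cvg_trans (@near_eq_cvg _ _ (nbhs x) _ _ _ (nfg x Ux)) (cf x Ux).
all: split=> // i; have [d1 d2] := df i; split=> [x Ux|].
  by apply: near_eq_derivable (d1 x Ux); exact: nfg.
apply: IH d2 => x Ux; apply: near_eq_derive; exact: nfg.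
Unshelve. all: by end_near. Qed.

Lemma Ck_cst k U (c : R) : Ck k U (fun=> c).
Proof.
elim: k c => [|k IH] c; split=> //; try by move=> x _; exact: cst_continuous.
move=> i; split=> [x _|]; first exact: derivable_cst.
have -> : 'D_(delta_mx 0 i) (fun=> c) = (fun=> 0) :> ('rV[R]_n -> R).
  by apply/funext => x; exact: derive_cst.
exact: IH.
Qed.

Lemma Ck_add k U f g : open U -> Ck k U f -> Ck k U g ->
  Ck k U (fun x => f x + g x).
Proof.
move=> oU; elim: k f g => [|k IH] f g [cf df] [cg dg].
  by split=> // x Ux; apply: continuousD; [exact: cf|exact: cg].
split=> [x Ux|i]; first by apply: continuousD; [exact: cf|exact: cg].
have [df1 df2] := df i; have [dg1 dg2] := dg i; split=> [x Ux|].
  by apply: derivableD; [exact: df1|exact: dg1].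
apply: (Ck_ext oU _ (IH _ _ df2 dg2)) => x Ux.
by rewrite -deriveD; [|exact: df1|exact: dg1].
Qed.

Lemma Ck_mul k U f g : open U -> Ck k U f -> Ck k U g ->
  Ck k U (fun x => f x * g x).
Proof.
move=> oU; elim: k f g => [|k IH] f g Cf Cg.
  split=> // x Ux; apply: continuousM;
  [exact: (Ck_cont Cf)|exact: (Ck_cont Cg)].
have [cf df] := Cf; have [cg dg] := Cg.
split=> [x Ux|i]; first by apply: continuousM; [exact: cf|exact: cg].
have [df1 df2] := df i; have [dg1 dg2] := dg i; split=> [x Ux|].
  by apply: derivableM; [exact: df1|exact: dg1].
apply: (Ck_ext oU _ (Ck_add oU (IH _ _ (CkS Cf) dg2) (IH _ _ (CkS Cg) df2))).
by move=> x Ux; rewrite -[LHS]/(f x *: _ + g x *: _) -deriveM;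
  [|exact: df1|exact: dg1].
Qed.

End Euclidean.

(* chart_inv i is only meaningful on the image of chart_dom i. *)
Record smooth_manifold (R : realType) (n : nat) := SmoothManifold {
  carrier :> topologicalType;
  hausdorff : hausdorff_space carrier;
  countable_basis : @second_countable carrier;
  chart_index : Type;
  chart_dom : chart_index -> set carrier;
  chart : chart_index -> carrier -> 'rV[R]_n;
  chart_inv : chart_index -> 'rV[R]_n -> carrier;
  chart_dom_open : forall i, open (chart_dom i);
  chart_cover : forall x, exists i, chart_dom i x;
  chart_im_open : forall i, open (chart i @` chart_dom i);
  chartK : forall i x, chart_dom i x -> chart_inv i (chart i x) = x;
  chart_cont : forall i x, chart_dom i x -> {for x, continuous (chart i)};
  chart_inv_cont : forall i x, chart_dom i x ->
    {for chart i x, continuous (chart_inv i)};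
  chart_transition : forall i j (k : 'I_n),
    smooth_on (chart i @` (chart_dom i `&` chart_dom j))
              (fun y => chart j (chart_inv i y) 0 k)
}.

Section Functions.
Variables (R : realType) (n : nat) (M : smooth_manifold R n).
Implicit Types (U : set M) (f g : M -> R).

Definition msmooth_on U f : Prop := forall i : chart_index M,
  smooth_on (chart i @` (chart_dom i `&` U)) (f \o chart_inv i).

Lemma chart_im_open_sub (i : chart_index M) U : open U ->
  open (chart i @` (chart_dom i `&` U)).
Proof.
move=> oU.
have -> : chart i @` (chart_dom i `&` U) =
  (chart i @` chart_dom i) `&` (chart_inv i @^-1` U).
  apply/seteqP; split=> y /=.
    by move=> [x [dx Ux] <-]; split; [exists x|rewrite chartK].
  by move=> [[x dx <-]]; rewrite chartK// => Ux; exists x.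
rewrite openE => y [[x dx xy] Uy]; rewrite /interior.
apply: filterI.
  by apply: open_nbhs_nbhs; split; [exact: chart_im_open|exists x].
move: Uy; rewrite -xy => Uy.
by apply: (chart_inv_cont dx); apply: open_nbhs_nbhs.
Qed.

Lemma msmooth_sub U V f : V `<=` U -> msmooth_on U f -> msmooth_on V f.
Proof.
move=> VU sf i k; apply: Ck_sub (sf i k).
by apply: image_subset => x [? /VU].
Qed.

Lemma msmooth_cst U (c : R) : msmooth_on U (fun=> c).
Proof. by move=> i k; exact: Ck_cst. Qed.

Lemma msmooth_add U f g : open U -> msmooth_on U f -> msmooth_on U g ->
  msmooth_on U (fun x => f x + g x).
Proof. by move=> oU sf sg i k; apply: Ck_add; [exact: chart_im_open_sub|exact: sf|exact: sg]. Qed.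

Lemma msmooth_mul U f g : open U -> msmooth_on U f -> msmooth_on U g ->
  msmooth_on U (fun x => f x * g x).
Proof. by move=> oU sf sg i k; apply: Ck_mul; [exact: chart_im_open_sub|exact: sf|exact: sg]. Qed.

Definition smooth_fun : {pred M -> R} := fun f => `[< msmooth_on setT f >].

Fact smooth_fun_subring : subring_closed smooth_fun.
Proof.
split=> [|f g|f g].
- by apply/asboolP; exact: msmooth_cst.
- move=> /asboolP sf /asboolP sg; apply/asboolP.
  have -> : f - g = (fun x => f x + (-1) * g x).
    by apply/funext => x; rewrite mulN1r.
  apply: msmooth_add => //; first exact: openT.
  by apply: msmooth_mul => //; [exact: openT|exact: msmooth_cst].
- by move=> /asboolP sf /asboolP sg; apply/asboolP; apply: msmooth_mul => //; exact: openT.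
Qed.
HB.instance Definition _ :=
  GRing.isSubringClosed.Build (M -> R) smooth_fun smooth_fun_subring.

Record Cinfty := CInfty { Cinfty_fun :> M -> R; Cinfty_smooth : Cinfty_fun \in smooth_fun }.
HB.instance Definition _ := [isSub for Cinfty_fun].
HB.instance Definition _ := [Choice of Cinfty by <:].
HB.instance Definition _ := 
  GRing.SubChoice_isSubComPzRing.Build _ _ Cinfty smooth_fun_subring.

Fact const_smooth (c : R) : (fun=> c : R) \in smooth_fun.
Proof. by apply/asboolP; exact: msmooth_cst. Qed.
Definition Cconst (c : R) : Cinfty := CInfty (const_smooth c).
End Functions.
Section Sections.
Variables (R : realType) (n : nat) (M : smooth_manifold R n).

(* triv t x and triv_inv t x are only meaningful for x in triv_dom t; the rank is
   locally constant. *)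
Record vector_bundle := VectorBundle {
  fibre : M -> lmodType R;
  triv_index : Type;
  triv_dom : triv_index -> set M;
  triv_rank : triv_index -> nat;
  triv : forall t x, {linear fibre x -> 'rV[R]_(triv_rank t)};
  triv_inv : forall t x, 'rV[R]_(triv_rank t) -> fibre x;
  triv_dom_open : forall t, open (triv_dom t);
  triv_cover : forall x, exists t, triv_dom t x;
  trivK : forall t x, triv_dom t x -> cancel (triv t x) (@triv_inv t x);
  triv_invK : forall t x, triv_dom t x -> cancel (@triv_inv t x) (triv t x);
  triv_transition : forall t t' (v : 'rV[R]_(triv_rank t)) (k : 'I_(triv_rank t')),
    msmooth_on (triv_dom t `&` triv_dom t')
      (fun x => triv t' x (@triv_inv t x v) 0 k)
}.

Variable E : vector_bundle.

Definition smooth_section (s : forall x, fibre E x) : Prop :=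
  forall (t : triv_index E) (k : 'I_(triv_rank t)),
    msmooth_on (triv_dom t) (fun x => triv t x (s x) 0 k).

Record section := MkSection {
  section_val :> forall x, fibre E x;
  section_smooth : smooth_section section_val }.

HB.instance Definition _ := gen_eqMixin section.
HB.instance Definition _ := gen_choiceMixin section.

Lemma section_ext (s t : section) : (forall x, s x = t x) -> s = t.
Proof.
case: s t => [s ps] [t pt] /= st; have {}st : s = t by apply: functional_extensionality_dep.
by move: ps pt; rewrite st => ps pt; congr MkSection; exact: Prop_irrelevance.
Qed.

Fact smooth_section0 : smooth_section (fun=> 0).
Proof.
move=> t k; have -> : (fun x => triv t x (0 : fibre E x) 0 k) = fun=> 0.
  by apply/funext => x; rewrite linear0 mxE.
exact: msmooth_cst.
Qed.

Fact smooth_sectionD (s t : section) : smooth_section (fun x => s x + t x).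
Proof.
move=> i k; have -> : (fun x => triv i x (s x + t x) 0 k) =
    fun x => triv i x (s x) 0 k + triv i x (t x) 0 k.
  by apply/funext => x; rewrite linearD mxE.
by apply: msmooth_add; [exact: triv_dom_open|exact: section_smooth..].
Qed.

Fact smooth_sectionZ (f : Cinfty M) (s : section) :
  smooth_section (fun x => f x *: s x).
Proof.
move=> i k; have -> : (fun x => triv i x (f x *: s x) 0 k) =
    fun x => f x * triv i x (s x) 0 k.
  by apply/funext => x; rewrite linearZ mxE.
apply: msmooth_mul; [exact: triv_dom_open| |exact: section_smooth].
by apply: (@msmooth_sub _ _ _ setT) => //; case: f => f /= /asboolP.
Qed.

Fact smooth_sectionN (s : section) : smooth_section (fun x => - s x).
Proof.
have -> : (fun x => - s x) = (fun x => (-1 : Cinfty M) x *: s x).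
  by apply: functional_extensionality_dep => x; rewrite scaleN1r.
exact: smooth_sectionZ.
Qed.

Definition section_add s t := MkSection (smooth_sectionD s t).
Definition section_opp s := MkSection (smooth_sectionN s).
Definition section_scale f s := MkSection (smooth_sectionZ f s).

Fact section_addA : associative section_add.
Proof. by move=> r s t; apply: section_ext => x /=; rewrite addrA. Qed.
Fact section_addC : commutative section_add.
Proof. by move=> r s; apply: section_ext => x /=; rewrite addrC. Qed.
Fact section_add0 : left_id (MkSection smooth_section0) section_add.
Proof. by move=> r; apply: section_ext => x /=; rewrite add0r. Qed.
Fact section_addN : left_inverse (MkSection smooth_section0) section_opp section_add.
Proof. by move=> r; apply: section_ext => x /=; rewrite addNr. Qed.
HB.instance Definition _ := GRing.isZmodule.Build section
  section_addA section_addC section_add0 section_addN.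

Fact section_scaleA f g s :
  section_scale f (section_scale g s) = section_scale (f * g) s.
Proof. by apply: section_ext => x /=; rewrite scalerA. Qed.
Fact section_scale1 : left_id 1 section_scale.
Proof. by move=> s; apply: section_ext => x /=; rewrite scale1r. Qed.
Fact section_scaleDr : right_distributive section_scale +%R.
Proof. by move=> f s t; apply: section_ext => x /=; rewrite scalerDr. Qed.
Fact section_scaleDl s : {morph section_scale^~ s : f g / f + g}.
Proof. by move=> f g; apply: section_ext => x /=; rewrite scalerDl. Qed.
HB.instance Definition _ := GRing.Zmodule_isLmodule.Build (Cinfty M) section
  section_scaleA section_scale1 section_scaleDr section_scaleDl.

End Sections.

(* zmod proves an identity in a zmodType; zmodh H proves one that differs from
   H by such an identity. *)
Inductive zexp := ZVar of nat | Zadd of zexp & zexp | Zopp of zexp | Zero.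

Fixpoint zeval (V : zmodType) (env : seq V) (e : zexp) : V :=
  match e with
  | ZVar i => nth 0 env i
  | Zadd a b => zeval env a + zeval env b
  | Zopp a => - zeval env a
  | Zero => 0
  end.

Fixpoint zpart (sgn : bool) (e : zexp) : seq nat :=
  match e with
  | ZVar i => if sgn then [:: i] else [::]
  | Zadd a b => zpart sgn a ++ zpart sgn b
  | Zopp a => zpart (~~ sgn) a
  | Zero => [::]
  end.

Lemma zevalE (V : zmodType) (env : seq V) e : zeval env e =
  \sum_(i <- zpart true e) nth 0 env i - \sum_(i <- zpart false e) nth 0 env i.
Proof.
elim: e => [i|a IHa b IHb|a IHa|] /=; rewrite ?big_cat/= ?big_seq1 ?big_nil ?subr0//.
  by rewrite IHa IHb opprD addrACA.
by rewrite IHa opprB.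
Qed.

Lemma zmod_correct (V : zmodType) (env : seq V) (a b : zexp) :
  perm_eq (zpart true a ++ zpart false b) (zpart true b ++ zpart false a) ->
  zeval env a = zeval env b.
Proof.
move=> ab; have : \sum_(i <- zpart true a ++ zpart false b) nth 0 env i =
    \sum_(i <- zpart true b ++ zpart false a) nth 0 env i by exact: perm_big.
rewrite !big_cat !zevalE /= => E.
by apply/eqP; rewrite subr_eq addrAC eq_sym subr_eq E.
Qed.

Lemma eq_from_sub (V : zmodType) (a b c d : V) : c = d -> a - b = c - d -> a = b.
Proof. by move=> ->; rewrite subrr => /eqP; rewrite subr_eq0 => /eqP. Qed.

Lemma addE (V : zmodType) (a b c d : V) : a = b -> c = d -> a + c = b + d.
Proof. by move=> -> ->. Qed.

Ltac zsame x y :=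
  match constr:(Set) with
  | _ => let _ := match constr:(Set) with _ => constr_eq x y end in constr:(true)
  | _ => let _ := match constr:(Set) with _ => unify x y end in constr:(true)
  | _ => constr:(false)
  end.
Ltac zlookup x l :=
  lazymatch l with
  | nil => constr:(O)
  | ?y :: ?l' =>
    let b := zsame x y in
    lazymatch b with
    | true => constr:(O)
    | false => let i := zlookup x l' in constr:(S i)
    end
  end.
Ltac zmem x l :=
  lazymatch l with
  | nil => constr:(false)
  | ?y :: ?l' =>
    let b := zsame x y in
    lazymatch b with true => constr:(true) | false => zmem x l' end
  end.
Ltac zatoms l t :=
  lazymatch t with
  | (?a + ?b)%R => let l1 := zatoms l a in zatoms l1 b
  | (- ?a)%R => zatoms l a
  | 0%R => l
  | _ => let b := zmem t l in
         lazymatch b with true => l | false => constr:(t :: l) end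
  end.
Ltac zreify l t :=
  lazymatch t with
  | (?a + ?b)%R =>
    let x := zreify l a in let y := zreify l b in constr:(Zadd x y)
  | (- ?a)%R => let x := zreify l a in constr:(Zopp x)
  | 0%R => constr:(Zero)
  | _ => let i := zlookup t l in constr:(ZVar i)
  end.
Ltac zmod :=
  lazymatch goal with
  | |- @eq ?V ?a ?b =>
    let l0 := zatoms (@nil V) a in
    let l := zatoms l0 b in
    let x := zreify l a in
    let y := zreify l b in
    refine (@zmod_correct _ l x y _); vm_compute; reflexivity
  end.
Ltac zmodh H :=
  first [refine (eq_from_sub H _); zmod | refine (eq_from_sub (esym H) _); zmod].

Section MultilinearDef.
Variables (C : comPzRingType) (U V W Z : lmodType C).

Definition bilin (f : U -> V -> W) : Prop :=
  (forall u, linear (f u)) /\ (forall v, linear (f^~ v)).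
Definition trilin (f : U -> V -> W -> Z) : Prop :=
  [/\ forall u v, linear (f u v), forall u w, linear (fun v => f u v w)
    & forall v w, linear (fun u => f u v w)].

End MultilinearDef.

Section Unary.
Variables (C : comPzRingType) (U V : lmodType C) (f : U -> V) (fL : linear f).
Lemma lin0 : f 0 = 0.
Proof. by have := fL (-1) 0 0; rewrite scaler0 addr0 scaleN1r addNr. Qed.
Lemma linD u v : f (u + v) = f u + f v.
Proof. by have := fL 1 u v; rewrite !scale1r. Qed.
Lemma linZ a u : f (a *: u) = a *: f u.
Proof. by have := fL a u 0; rewrite lin0 !addr0. Qed.
Lemma linN u : f (- u) = - f u.
Proof. by rewrite -scaleN1r linZ scaleN1r. Qed.
End Unary.

Section Binary.
Variables (C : comPzRingType) (U V W : lmodType C) (f : U -> V -> W) (fB : bilin f).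
Lemma bilin0l v : f 0 v = 0. Proof. exact: (lin0 (fB.2 v)). Qed.
Lemma bilin0r u : f u 0 = 0. Proof. exact: (lin0 (fB.1 u)). Qed.
Lemma bilinDl u u' v : f (u + u') v = f u v + f u' v.
Proof. exact: (linD (fB.2 v)). Qed.
Lemma bilinDr u v v' : f u (v + v') = f u v + f u v'.
Proof. exact: (linD (fB.1 u)). Qed.
Lemma bilinNl u v : f (- u) v = - f u v.
Proof. exact: (linN (fB.2 v)). Qed.
Lemma bilinNr u v : f u (- v) = - f u v.
Proof. exact: (linN (fB.1 u)). Qed.
Lemma bilinZl a u v : f (a *: u) v = a *: f u v.
Proof. exact: (linZ (fB.2 v)). Qed.
Lemma bilinZr a u v : f u (a *: v) = a *: f u v.
Proof. exact: (linZ (fB.1 u)). Qed.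
Definition bilinE := (bilin0l, bilin0r, bilinDl, bilinDr, bilinNl, bilinNr).
Definition bilinZ := (bilinZl, bilinZr).
End Binary.

Section Ternary.
Variables (C : comPzRingType) (U V W Z : lmodType C) (f : U -> V -> W -> Z) (fT : trilin f).
Lemma trilin0_1 v w : f 0 v w = 0.
Proof. by case: fT => _ _ h; exact: (lin0 (h v w)). Qed.
Lemma trilin0_2 u w : f u 0 w = 0.
Proof. by case: fT => _ h _; exact: (lin0 (h u w)). Qed.
Lemma trilin0_3 u v : f u v 0 = 0.
Proof. by case: fT => h _ _; exact: (lin0 (h u v)). Qed.
Lemma trilinD1 u u' v w : f (u + u') v w = f u v w + f u' v w.
Proof. by case: fT => _ _ h; exact: (linD (h v w)). Qed.
Lemma trilinD2 u v v' w : f u (v + v') w = f u v w + f u v' w.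
Proof. by case: fT => _ h _; exact: (linD (h u w)). Qed.
Lemma trilinD3 u v w w' : f u v (w + w') = f u v w + f u v w'.
Proof. by case: fT => h _ _; exact: (linD (h u v)). Qed.
Lemma trilinN1 u v w : f (- u) v w = - f u v w.
Proof. by case: fT => _ _ h; exact: (linN (h v w)). Qed.
Lemma trilinN2 u v w : f u (- v) w = - f u v w.
Proof. by case: fT => _ h _; exact: (linN (h u w)). Qed.
Lemma trilinN3 u v w : f u v (- w) = - f u v w.
Proof. by case: fT => h _ _; exact: (linN (h u v)). Qed.
Lemma trilinZ1 a u v w : f (a *: u) v w = a *: f u v w.
Proof. by case: fT => _ _ h; exact: (linZ (h v w)). Qed.
Lemma trilinZ2 a u v w : f u (a *: v) w = a *: f u v w.
Proof. by case: fT => _ h _; exact: (linZ (h u w)). Qed.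
Lemma trilinZ3 a u v w : f u v (a *: w) = a *: f u v w.
Proof. by case: fT => h _ _; exact: (linZ (h u v)). Qed.
Definition trilinE := (trilin0_1, trilin0_2, trilin0_3, trilinD1, trilinD2,
  trilinD3, trilinN1, trilinN2, trilinN3).
Definition trilinZ := (trilinZ1, trilinZ2, trilinZ3).
End Ternary.

Definition skew2 (U V : zmodType) (f : U -> U -> V) : Prop :=
  forall u v, f u v = - f v u.
Definition skew3 (U V : zmodType) (f : U -> U -> U -> V) : Prop :=
  (forall u v w, f u v w = - f v u w) /\ (forall u v w, f u v w = - f u w v).

Section HomModules.
Variables (C : comPzRingType) (U V : lmodType C).

Definition is_hom : {pred U -> V} := fun f => `[< linear f >].
Fact is_hom_closed : subsemimod_closed is_hom.
Proof.
split; [split|].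
- by apply/asboolP => a u v; rewrite /= scaler0 addr0.
- move=> f g /asboolP fL /asboolP gL; apply/asboolP => a u v /=.
  by rewrite -[LHS]/(f _ + g _) -[RHS]/(a *: (f u + g u) + (f v + g v)) fL gL scalerDr; zmod.
- move=> c f /asboolP fL; apply/asboolP => a u v.
  rewrite -[LHS]/(c *: f _) -[RHS]/(a *: (c *: f u) + c *: f v).
  by rewrite fL scalerDr !scalerA mulrC.
Qed.
Record hom := Hom { hom_fun :> U -> V; homP : hom_fun \in is_hom }.
HB.instance Definition _ := [isSub for hom_fun].
HB.instance Definition _ := [Choice of hom by <:].
HB.instance Definition _ :=
  GRing.SubChoice_isSubLmodule.Build C (U -> V) is_hom hom is_hom_closed.

Definition is_alt2 : {pred U -> U -> V} := fun f => `[< bilin f /\ skew2 f >].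
Fact is_alt2_closed : subsemimod_closed is_alt2.
Proof.
split; [split|].
- apply/asboolP; split; first split.
  + by move=> u a v w; rewrite /= scaler0 addr0.
  + by move=> u a v w; rewrite /= scaler0 addr0.
  + by move=> u v; rewrite /= oppr0.
- move=> f g /asboolP[fB fS] /asboolP[gB gS]; apply/asboolP; split; first split.
  + move=> u a v w; rewrite -[LHS]/(f _ _ + g _ _) -[RHS]/(a *: (f _ _ + g _ _) + (f _ _ + g _ _)).
    by rewrite !(bilinE fB, bilinE gB, bilinZ fB, bilinZ gB) scalerDr; zmod.
  + move=> u a v w; rewrite -[LHS]/(f _ _ + g _ _) -[RHS]/(a *: (f _ _ + g _ _) + (f _ _ + g _ _)).
    by rewrite !(bilinE fB, bilinE gB, bilinZ fB, bilinZ gB) scalerDr; zmod.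
  + by move=> u v; rewrite -[LHS]/(f _ _ + g _ _) -[RHS]/(- (f _ _ + g _ _)) fS gS; zmod.
- move=> c f /asboolP[fB fS]; apply/asboolP; split; first split.
  + move=> u a v w; rewrite -[LHS]/(c *: f _ _) -[RHS]/(a *: (c *: f _ _) + (c *: f _ _)).
    by rewrite !(bilinE fB, bilinZ fB) scalerDr !scalerA mulrC.
  + move=> u a v w; rewrite -[LHS]/(c *: f _ _) -[RHS]/(a *: (c *: f _ _) + (c *: f _ _)).
    by rewrite !(bilinE fB, bilinZ fB) scalerDr !scalerA mulrC.
  + by move=> u v; rewrite -[LHS]/(c *: f _ _) -[RHS]/(- (c *: f _ _)) fS scalerN.
Qed.
Record alt2 := Alt2 { alt2_fun :> U -> U -> V; alt2P : alt2_fun \in is_alt2 }.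
HB.instance Definition _ := [isSub for alt2_fun].
HB.instance Definition _ := [Choice of alt2 by <:].
HB.instance Definition _ :=
  GRing.SubChoice_isSubLmodule.Build C (U -> U -> V) is_alt2 alt2 is_alt2_closed.

Lemma hom_lin (f : hom) : linear f. Proof. by case: f => f /= /asboolP. Qed.
Lemma alt2_bilin (f : alt2) : bilin f. Proof. by case: f => f /= /asboolP[]. Qed.
Lemma alt2_skew (f : alt2) : skew2 f. Proof. by case: f => f /= /asboolP[]. Qed.
Lemma hom_ext (f g : hom) : f =1 g -> f = g.
Proof. by move=> fg; apply: val_inj; apply/funext. Qed.
Lemma alt2_ext (f g : alt2) : f =2 g -> f = g.
Proof. by move=> fg; apply: val_inj; apply/funext => u; apply/funext => v; exact: fg. Qed.
Definition mkhom (f : U -> V) (fL : linear f) : hom := Hom (introT (asboolP _) fL : f \in is_hom).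
Definition mkalt2 (f : U -> U -> V) (fB : bilin f) (fS : skew2 f) : alt2 :=
  Alt2 (introT (asboolP _) (conj fB fS) : f \in is_alt2).
End HomModules.
Arguments hom_fun : simpl never.
Arguments alt2_fun : simpl never.

Section Kernel.
Variables (C : comPzRingType) (U V : lmodType C) (f : {linear U -> V}).
Definition in_ker : {pred U} := fun u => f u == 0.
Fact in_ker_closed : subsemimod_closed in_ker.
Proof.
split; [split|]; rewrite /in_ker.
- by rewrite unfold_in linear0.
- by move=> u v; rewrite !unfold_in linearD => /eqP-> /eqP->; rewrite addr0.
- by move=> a u; rewrite !unfold_in linearZ /= => /eqP->; rewrite scaler0.
Qed.
Record kermod := Kermod { ker_val : U; kerP : ker_val \in in_ker }.
HB.instance Definition _ := [isSub for ker_val].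
HB.instance Definition _ := [Choice of kermod by <:].
HB.instance Definition _ :=
  GRing.SubChoice_isSubLmodule.Build C U in_ker kermod in_ker_closed.
Definition mkker (u : U) (fu : f u = 0) : kermod := Kermod (introT eqP fu : u \in in_ker).
Lemma ker0 (u : kermod) : f (ker_val u) = 0. Proof. by apply/eqP; case: u. Qed.
End Kernel.

Section VectorFields.
Variables (R : realType) (n : nat) (M : smooth_manifold R n).
Local Notation C := (Cinfty M).
Local Notation const := (@Cconst R n M).

Definition is_vfield : {pred C -> C^o} := fun D =>
  `[< [/\ forall f g, D (f + g) = D f + D g,
          forall c f, D (const c * f) = const c * D f
        & forall f g, D (f * g) = f * D g + D f * g] >].
Fact is_vfield_closed : subsemimod_closed is_vfield.
Proof.
split; [split|].
- apply/asboolP; split=> [f g|c f|f g] /=; first by rewrite addr0.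
    by rewrite mulr0.
  by rewrite mulr0 mul0r addr0.
- move=> X Y /asboolP[XD XZ XL] /asboolP[YD YZ YL]; apply/asboolP.
  have E f : (X + Y) f = X f + Y f by [].
  split=> [f g|c f|f g]; rewrite !E.
  + by rewrite XD YD; zmod.
  + by rewrite XZ YZ mulrDr.
  + by rewrite XL YL mulrDr mulrDl; zmod.
- move=> a X /asboolP[XD XZ XL]; apply/asboolP.
  have E f : (a *: X) f = a * X f by [].
  split=> [f g|c f|f g]; rewrite !E.
  + by rewrite XD mulrDr.
  + by rewrite XZ mulrCA.
  + by rewrite XL mulrDr [in LHS]mulrCA [a * (X f * g)]mulrA.
Qed.
Record vfield := Vfield { vf_fun : C -> C^o; vfP : vf_fun \in is_vfield }.
HB.instance Definition _ := [isSub for vf_fun].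
HB.instance Definition _ := [Choice of vfield by <:].
HB.instance Definition _ :=
  GRing.SubChoice_isSubLmodule.Build C (C -> C^o) is_vfield vfield is_vfield_closed.

Definition vf_app (X : vfield) (f : C) : C := vf_fun X f.
Coercion vf_app : vfield >-> Funclass.

Lemma vfieldP (X : vfield) : [/\ forall f g, X (f + g) = X f + X g,
   forall c f, X (const c * f) = const c * X f & forall f g, X (f * g) = f * X g + X f * g].
Proof. by case: X => X /= /asboolP[]. Qed.
Lemma vfD (X : vfield) f g : X (f + g) = X f + X g. Proof. by case: (vfieldP X). Qed.
Lemma vfM (X : vfield) f g : X (f * g) = f * X g + X f * g. Proof. by case: (vfieldP X). Qed.
Lemma vfZ (X : vfield) c f : X (const c * f) = const c * X f. Proof. by case: (vfieldP X). Qed.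
Lemma vf0 (X : vfield) : X 0 = 0.
Proof. by apply: (@addrI _ (X 0)); rewrite -vfD !addr0. Qed.
Lemma vfN (X : vfield) f : X (- f) = - X f.
Proof. by apply: (@addrI _ (X f)); rewrite -vfD !subrr vf0. Qed.
Lemma vf_ext (X Y : vfield) : X =1 Y -> X = Y.
Proof. by move=> XY; apply: val_inj; apply/funext. Qed.
Lemma vf_const (X : vfield) c : X (const c) = 0.
Proof.
have := vfM X (const c) 1; rewrite vfZ mulr1 => H.
by apply: (@addrI _ (const c * X 1)); rewrite addr0 -H.
Qed.

Fact bracket_subproof (X Y : vfield) : (fun f => X (Y f) - Y (X f)) \in is_vfield.
Proof.
apply/asboolP; split=> [f g|c f|f g].
- by rewrite !vfD; zmod.
- by rewrite !vfZ mulrBr.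
- by rewrite !(vfM, vfD) mulrBr mulrBl; zmod.
Qed.
Definition lie_bracket (X Y : vfield) : vfield := Vfield (bracket_subproof X Y).

Lemma bracketE X Y f : lie_bracket X Y f = X (Y f) - Y (X f). Proof. by []. Qed.
Lemma vf_addE (X Y : vfield) f : (X + Y) f = X f + Y f. Proof. by []. Qed.
Lemma vf_scaleE a (X : vfield) f : (a *: X) f = a * X f. Proof. by []. Qed.
Lemma vf_oppE (X : vfield) f : (- X) f = - X f. Proof. by []. Qed.

Definition rlinear (U V : lmodType C) (f : U -> V) : Prop :=
  forall c u v, f (const c *: u + v) = const c *: f u + f v.
Definition rbilin (U V W : lmodType C) (f : U -> V -> W) : Prop :=
  (forall u, rlinear (f u)) /\ (forall v, rlinear (f^~ v)).

End VectorFields.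
Arguments vfield {R n} M.
Arguments vf_app : simpl never.

(* l20 and l21 are l2 on V0 x V0 and on V0 x V1, where V1 is the degree -1 part;
   l2(m, x) stands for - l21 x m.  In law_coh the term - l21 z (l3 w x y) is
   l2(l3(w,x,y), z). *)
Record lie2_laws (V1 V0 : zmodType) (l1 : V1 -> V0) (l20 : V0 -> V0 -> V0)
    (l21 : V0 -> V1 -> V1) (l3 : V0 -> V0 -> V0 -> V1) : Prop := Lie2Laws {
  law_skew2 : skew2 l20;
  law_skew3 : skew3 l3;
  law_l1l2 : forall x m, l1 (l21 x m) = l20 x (l1 m);
  law_l2l1 : forall m p, l21 (l1 m) p = - l21 (l1 p) m;
  law_jac0 : forall x y z,
    l1 (l3 x y z) = l20 x (l20 y z) - l20 (l20 x y) z - l20 y (l20 x z);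
  law_jac1 : forall x y m,
    l3 x y (l1 m) = l21 x (l21 y m) - l21 (l20 x y) m - l21 y (l21 x m);
  law_coh : forall w x y z,
    l21 w (l3 x y z) - l21 x (l3 w y z) + l21 y (l3 w x z)
    + - l21 z (l3 w x y)
    - l3 (l20 w x) y z - l3 x (l20 w y) z - l3 x y (l20 w z)
    + l3 w (l20 x y) z + l3 w y (l20 x z) - l3 w x (l20 y z) = 0
}.

Section Structures.
Variables (R : realType) (n : nat) (M : smooth_manifold R n).
Local Notation C := (Cinfty M).
Local Notation const := (@Cconst R n M).

Record lie2_bundle (G1 G0 : lmodType C) := Lie2Bundle {
  k1 : {linear G1 -> G0};
  k20 : G0 -> G0 -> G0;
  k21 : G0 -> G1 -> G1;
  k3 : G0 -> G0 -> G0 -> G1;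
  k20_bilin : bilin k20;
  k21_bilin : bilin k21;
  k3_trilin : trilin k3;
  bundle_laws : lie2_laws k1 k20 k21 k3
}.

(* The anchor is extended by zero to degree -1, so l2(m, f x) = f l2(m, x): this
   is l21_linl.  Without it l21 would not be tensorial in sections of ker rho
   (S1 = S0 = vfield M with l1 = id and l2 the Lie bracket would be allowed). *)
Record lie2_algebroid_on (S1 S0 : lmodType C) := Lie2Algebroid {
  rho : {linear S0 -> vfield M};
  l1 : {linear S1 -> S0};
  l20 : S0 -> S0 -> S0;
  l21 : S0 -> S1 -> S1;
  l3 : S0 -> S0 -> S0 -> S1;
  l20_rbilin : rbilin l20;
  l21_rbilin : rbilin l21;
  l3_trilin : trilin l3;
  algebroid_laws : lie2_laws l1 l20 l21 l3;
  l20_leibniz : forall x (f : C) y, l20 x (f *: y) = f *: l20 x y + rho x f *: y;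
  l21_leibniz : forall x (f : C) m, l21 x (f *: m) = f *: l21 x m + rho x f *: m;
  l21_linl : forall (f : C) x m, l21 (f *: x) m = f *: l21 x m
}.

Lemma const1 : const 1 = 1 :> C. Proof. by apply: val_inj. Qed.
Lemma constN c : const (- c) = - const c :> C. Proof. by apply: val_inj. Qed.

Section Rlin.
Variables (U V : lmodType C) (f : U -> V) (fL : rlinear f).
Lemma rlinD u v : f (u + v) = f u + f v.
Proof. by have := fL 1 u v; rewrite const1 !scale1r. Qed.
Lemma rlin0 : f 0 = 0.
Proof. by apply: (@addrI _ (f 0)); rewrite -rlinD !addr0. Qed.
Lemma rlinN u : f (- u) = - f u.
Proof. by apply: (@addrI _ (f u)); rewrite -rlinD !subrr rlin0. Qed.
End Rlin.
Section Rbilin.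
Variables (U V W : lmodType C) (f : U -> V -> W) (fB : rbilin f).
Lemma rbilin0l v : f 0 v = 0. Proof. exact: (rlin0 (fB.2 v)). Qed.
Lemma rbilin0r u : f u 0 = 0. Proof. exact: (rlin0 (fB.1 u)). Qed.
Lemma rbilinDl u u' v : f (u + u') v = f u v + f u' v.
Proof. exact: (rlinD (fB.2 v)). Qed.
Lemma rbilinDr u v v' : f u (v + v') = f u v + f u v'.
Proof. exact: (rlinD (fB.1 u)). Qed.
Lemma rbilinNl u v : f (- u) v = - f u v.
Proof. exact: (rlinN (fB.2 v)). Qed.
Lemma rbilinNr u v : f u (- v) = - f u v.
Proof. exact: (rlinN (fB.1 u)). Qed.
Definition rbilinE := (rbilin0l, rbilin0r, rbilinDl, rbilinDr, rbilinNl, rbilinNr).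
End Rbilin.

Lemma Cinfty_reduced (f : C) : f * f = 0 -> f = 0.
Proof.
move=> ff; apply: val_inj; apply/funext => x.
have : (f * f) x = 0 by rewrite ff.
by rewrite -[LHS]/(f x * f x) => /eqP; rewrite mulf_eq0 orbb => /eqP.
Qed.

Section Restriction.
Variables (S1 S0 : lmodType C) (A : lie2_algebroid_on S1 S0).
Notation ρ := (rho A).

Lemma l20_leibniz_l f x y : l20 A (f *: x) y = f *: l20 A x y - rho A y f *: x.
Proof.
have s := law_skew2 (algebroid_laws A).
by rewrite s l20_leibniz (s y x) scalerN; zmod.
Qed.

Lemma rho_l1 m : rho A (l1 A m) = 0.
Proof.
have L := algebroid_laws A.
suff E f (x : S0) : rho A (l1 A m) f *: x = 0.
  apply: vf_ext => f; apply: Cinfty_reduced.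
  by have := congr1 (fun x => rho A x f) (E f (l1 A m)); rewrite linearZ linear0.
have E1 := law_l1l2 L (f *: x) m; rewrite l20_leibniz_l l21_linl linearZ /= (law_l1l2 L) in E1.
by zmodh (esym E1).
Qed.

Lemma rho_l2 x y : rho A (l20 A x y) = lie_bracket (rho A x) (rho A y).
Proof.
have L := algebroid_laws A; have B := l20_rbilin A.
pose P := lie_bracket (rho A x) (rho A y) - rho A (l20 A x y).
have PE f : P f = rho A x (rho A y f) - rho A y (rho A x f) - rho A (l20 A x y) f.
  by [].
suff P0 : P = 0 by apply/esym/eqP; rewrite -subr_eq0; apply/eqP.
have E f (z : S0) : P f *: z = 0.
  have H := law_jac0 L x y (f *: z).
  rewrite (trilinZ3 (l3_trilin A)) linearZ /= (law_jac0 L) in H.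
  rewrite !(l20_leibniz, rbilinE B) !(scalerDr, scalerN) in H.
  rewrite PE !(scalerDl, scaleNr).
  by zmodh (esym H).
have E' f z g : P f * rho A z g = 0.
  by have := congr1 (fun x => rho A x g) (E f z); rewrite linearZ linear0.
apply: vf_ext => f; apply: Cinfty_reduced.
by rewrite [X in _ * X]PE !mulrDr !mulrN !E' !oppr0 !addr0.
Qed.

Notation G := (kermod (rho A)).
Local Notation kv := (@ker_val _ _ _ (rho A)).
Lemma ker_ext (u v : G) : kv u = kv v -> u = v. Proof. exact: val_inj. Qed.

Lemma bracket0l X : lie_bracket 0 X = 0 :> vfield M.
Proof. by apply: vf_ext => f; rewrite bracketE vf0 subr0. Qed.
Lemma bracket0r X : lie_bracket X 0 = 0 :> vfield M.
Proof. by apply: vf_ext => f; rewrite bracketE vf0 subr0. Qed.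

Lemma rho_l2_ker x (u : G) : rho A (l20 A x (kv u)) = 0.
Proof. by rewrite rho_l2 ker0 bracket0r. Qed.

Definition iso_l1 (m : S1) : G := mkker (rho_l1 m).
Definition iso_l20 (u v : G) : G := mkker (rho_l2_ker (kv u) v).
Definition iso_l21 (u : G) (m : S1) : S1 := l21 A (kv u) m.
Definition iso_l3 (u v w : G) : S1 := l3 A (kv u) (kv v) (kv w).

Fact iso_l1_linear : linear iso_l1.
Proof. by move=> a u v; apply: ker_ext; rewrite /= linearP. Qed.
HB.instance Definition _ := GRing.isLinear.Build C S1 G *:%R iso_l1 iso_l1_linear.

Fact iso_l20_bilin : bilin iso_l20.
Proof.
have B := l20_rbilin A.
split=> [u|v] a x y; apply: ker_ext; rewrite /=.
  by rewrite rbilinDr// l20_leibniz ker0 scale0r addr0.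
by rewrite rbilinDl// l20_leibniz_l ker0 scale0r subr0.
Qed.
Fact iso_l21_bilin : bilin iso_l21.
Proof.
have B := l21_rbilin A.
split=> [u|v] a x y; rewrite /iso_l21 /=.
  by rewrite rbilinDr// l21_leibniz ker0 scale0r addr0.
by rewrite rbilinDl// l21_linl.
Qed.
Fact iso_l3_trilin : trilin iso_l3.
Proof.
have [h1 h2 h3] := l3_trilin A.
by split=> [u v|u w|v w] a x y; [exact: h1|exact: h2|exact: h3].
Qed.
Fact iso_laws : lie2_laws iso_l1 iso_l20 iso_l21 iso_l3.
Proof.
have [s2 [s3 s3'] a1 a2 a3 a4 a5] := algebroid_laws A.
split.
- by move=> u v; apply: ker_ext; exact: s2.
- by split=> u v w; [exact: s3|exact: s3'].
- by move=> u m; apply: ker_ext; exact: a1.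
- by move=> m p; exact: a2.
- by move=> u v w; apply: ker_ext; exact: a3.
- by move=> u v m; exact: a4.
- by move=> w x y z; exact: a5.
Qed.

Definition isotropy : lie2_bundle S1 G :=
  @Lie2Bundle S1 G iso_l1 iso_l20 iso_l21 iso_l3
    iso_l20_bilin iso_l21_bilin iso_l3_trilin iso_laws.
End Restriction.

Record lie_algebroid (S : lmodType C) := LieAlgebroid {
  la_rho : {linear S -> vfield M};
  la_l2 : S -> S -> S;
  la_rbilin : rbilin la_l2;
  la_skew : skew2 la_l2;
  la_jacobi : forall x y z,
    la_l2 x (la_l2 y z) = la_l2 (la_l2 x y) z + la_l2 y (la_l2 x z);
  la_leibniz : forall x (f : C) y,
    la_l2 x (f *: y) = f *: la_l2 x y + la_rho x f *: y
}.

Fact bracket_rbilin : rbilin (@lie_bracket R n M).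
Proof.
split=> [X|Y] c Z W; apply: vf_ext => f;
by rewrite !(bracketE, vf_addE, vf_scaleE) !(vfD, vfZ) mulrBr; zmod.
Qed.
Fact bracket_skew : skew2 (@lie_bracket R n M).
Proof. by move=> X Y; apply: vf_ext => f; rewrite vf_oppE !bracketE; zmod. Qed.
Fact bracket_jacobi (X Y Z : vfield M) :
  lie_bracket X (lie_bracket Y Z) = lie_bracket (lie_bracket X Y) Z + lie_bracket Y (lie_bracket X Z).
Proof.
by apply: vf_ext => f; rewrite vf_addE !bracketE !(vfD, vfN); zmod.
Qed.
Fact bracket_leibniz (X : vfield M) (f : C) Y :
  lie_bracket X (f *: Y) = f *: lie_bracket X Y + (idfun X : vfield M) f *: Y.
Proof.
apply: vf_ext => g.
by rewrite vf_addE !(vf_scaleE, bracketE) vfM mulrBr /=; zmod.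
Qed.
Definition tangent : lie_algebroid (vfield M) :=
  @LieAlgebroid (vfield M) idfun (@lie_bracket R n M)
    bracket_rbilin bracket_skew bracket_jacobi bracket_leibniz.

(* s_d2, s_d1 are the differential on degrees -2, -1, and s_ij is the bracket of
   degrees -i and -j; the remaining components are determined by graded skew
   symmetry, [a, x] = - s01 x a and [c, x] = - s02 x c, or vanish for degree
   reasons.  As above the anchor is zero in negative degrees. *)
Record strict_lie3 (S2 S1 S0 : lmodType C) := StrictLie3 {
  s_rho : {linear S0 -> vfield M};
  s_d2 : {linear S2 -> S1};
  s_d1 : {linear S1 -> S0};
  s00 : S0 -> S0 -> S0;
  s01 : S0 -> S1 -> S1;
  s02 : S0 -> S2 -> S2;
  s11 : S1 -> S1 -> S2;
  s00_rbilin : rbilin s00;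
  s01_rbilin : rbilin s01;
  s02_rbilin : rbilin s02;
  s11_bilin : bilin s11;
  s00_skew : skew2 s00;
  s11_sym : forall a b, s11 a b = s11 b a;
  s_dd : forall c, s_d1 (s_d2 c) = 0;
  s_der01 : forall x a, s_d1 (s01 x a) = s00 x (s_d1 a);
  s_der02 : forall x c, s_d2 (s02 x c) = s01 x (s_d2 c);
  s_der11 : forall a b, s_d2 (s11 a b) = s01 (s_d1 a) b + s01 (s_d1 b) a;
  s_der12 : forall a c, s02 (s_d1 a) c = s11 a (s_d2 c);
  s_jac000 : forall x y z, s00 x (s00 y z) = s00 (s00 x y) z + s00 y (s00 x z);
  s_jac001 : forall x y a, s01 x (s01 y a) = s01 (s00 x y) a + s01 y (s01 x a);
  s_jac002 : forall x y c, s02 x (s02 y c) = s02 (s00 x y) c + s02 y (s02 x c);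
  s_jac011 : forall x a b, s02 x (s11 a b) = s11 (s01 x a) b + s11 a (s01 x b);
  s00_leibniz : forall x (f : C) y, s00 x (f *: y) = f *: s00 x y + s_rho x f *: y;
  s01_leibniz : forall x (f : C) a, s01 x (f *: a) = f *: s01 x a + s_rho x f *: a;
  s02_leibniz : forall x (f : C) c, s02 x (f *: c) = f *: s02 x c + s_rho x f *: c;
  s01_linl : forall (f : C) x a, s01 (f *: x) a = f *: s01 x a;
  s02_linl : forall (f : C) x c, s02 (f *: x) c = f *: s02 x c
}.

Record lie3_morphism (S : lmodType C) (A : lie_algebroid S)
    (S2 S1 S0 : lmodType C) (L : strict_lie3 S2 S1 S0) := Lie3Morphism {
  F1 : {linear S -> S0};
  F2 : S -> S -> S1;
  F3 : S -> S -> S -> S2;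
  F2_bilin : bilin F2;
  F2_skew : skew2 F2;
  F3_trilin : trilin F3;
  F3_skew : skew3 F3;
  F_anchor : forall X, s_rho L (F1 X) = la_rho A X;
  F_eq2 : forall X Y,
    F1 (la_l2 A X Y) - s00 L (F1 X) (F1 Y) = s_d1 L (F2 X Y);
  F_eq3 : forall X Y Z,
    (s01 L (F1 X) (F2 Y Z) - F2 (la_l2 A X Y) Z)
    + (s01 L (F1 Y) (F2 Z X) - F2 (la_l2 A Y Z) X)
    + (s01 L (F1 Z) (F2 X Y) - F2 (la_l2 A Z X) Y) = s_d2 L (F3 X Y Z);
  F_eq4 : forall X1 X2 X3 X4,
    let T Xi Xj Xk Xl := F3 (la_l2 A Xi Xj) Xk Xl
      - const 2^-1 *: s11 L (F2 Xi Xj) (F2 Xk Xl) in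
    s02 L (F1 X1) (F3 X2 X3 X4) - s02 L (F1 X2) (F3 X1 X3 X4)
    + s02 L (F1 X3) (F3 X1 X2 X4) - s02 L (F1 X4) (F3 X1 X2 X3)
    + (- T X1 X2 X3 X4 + T X1 X3 X2 X4 - T X1 X4 X2 X3
       - T X2 X3 X1 X4 + T X2 X4 X1 X3 - T X3 X4 X1 X2) = 0
}.

End Structures.

Section CDO.
Variables (R : realType) (n : nat) (M : smooth_manifold R n).
Local Notation C := (Cinfty M).
Local Notation const := (@Cconst R n M).
Variable E : lmodType C.

(* Sections of the bundle of covariant differential operators of E carry their
   symbol as data: it is determined by the operator wherever E has positive rank,
   and for E = 0 the bundle is TM. *)
Definition is_cdo : {pred (E -> E) * vfield M} := fun D =>
  `[< rlinear D.1 /\ forall (f : C) e, D.1 (f *: e) = f *: D.1 e + D.2 f *: e >].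
Fact is_cdo_closed : subsemimod_closed is_cdo.
Proof.
split; [split|].
- apply/asboolP; split=> [c u v|f e] /=; first by rewrite scaler0 addr0.
  by rewrite -[vf_app 0 f]/(0 : C) scale0r scaler0 addr0.
- move=> [D X] [D' X'] /asboolP[/= DR DL] /asboolP[/= DR' DL'].
  have E1 e : (D + D') e = D e + D' e by [].
  apply/asboolP; split=> [c u v|f e] /=; rewrite !E1.
    by rewrite DR DR' scalerDr; zmod.
  by rewrite DL DL' scalerDr vf_addE scalerDl; zmod.
- move=> a [D X] /asboolP[/= DR DL].
  have E1 e : (a *: D) e = a *: D e by [].
  apply/asboolP; split=> [c u v|f e] /=; rewrite !E1.
    by rewrite DR scalerDr !scalerA mulrC.
  by rewrite DL scalerDr vf_scaleE !scalerA [a * f]mulrC.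
Qed.
Record cdo := Cdo { cdo_val : (E -> E) * vfield M; cdoP : cdo_val \in is_cdo }.
HB.instance Definition _ := [isSub for cdo_val].
HB.instance Definition _ := [Choice of cdo by <:].
HB.instance Definition _ := GRing.SubChoice_isSubLmodule.Build
  C ((E -> E) * vfield M)%type is_cdo cdo is_cdo_closed.

Definition cdo_app (D : cdo) : E -> E := (cdo_val D).1.
Coercion cdo_app : cdo >-> Funclass.
Definition symb (D : cdo) : vfield M := (cdo_val D).2.

Lemma cdo_rlin (D : cdo) : rlinear D.
Proof. by have /asboolP[] := cdoP D. Qed.
Lemma cdo_leibniz (D : cdo) (f : C) e : D (f *: e) = f *: D e + symb D f *: e.
Proof. by have /asboolP[_ h] := cdoP D; exact: h. Qed.
Lemma cdo0 (D : cdo) : D 0 = 0. Proof. exact: (rlin0 (cdo_rlin D)). Qed.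
Lemma cdoD (D : cdo) u v : D (u + v) = D u + D v.
Proof. exact: (rlinD (cdo_rlin D)). Qed.
Lemma cdoN (D : cdo) u : D (- u) = - D u.
Proof. exact: (rlinN (cdo_rlin D)). Qed.
Lemma cdoZ (D : cdo) c u : D (const c *: u) = const c *: D u.
Proof. by have := cdo_rlin D c u 0; rewrite cdo0 !addr0. Qed.
Lemma cdo_ext (D D' : cdo) : D =1 D' -> symb D = symb D' -> D = D'.
Proof.
case: D D' => [[D X] p] [[D' X'] p']; rewrite /cdo_app /symb /= => DD XX.
by apply: val_inj => /=; rewrite XX; congr pair; apply/funext.
Qed.
Definition mkcdo (D : E -> E) (X : vfield M) (DR : rlinear D)
  (DL : forall (f : C) e, D (f *: e) = f *: D e + X f *: e) : cdo :=
  Cdo (introT (asboolP _) (conj DR DL) : (D, X) \in is_cdo).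

Lemma cdo_0E e : (0 : cdo) e = 0. Proof. by []. Qed.
Lemma cdo_addE (D D' : cdo) e : (D + D') e = D e + D' e. Proof. by []. Qed.
Lemma cdo_scaleE a (D : cdo) e : (a *: D) e = a *: D e. Proof. by []. Qed.
Lemma symbD (D D' : cdo) : symb (D + D') = symb D + symb D'. Proof. by []. Qed.
Lemma symbZ a (D : cdo) : symb (a *: D) = a *: symb D. Proof. by []. Qed.

Fact cdo_bracket_rlin (D D' : cdo) : rlinear (fun e => D (D' e) - D' (D e)).
Proof. by move=> c u v; rewrite !(cdoD, cdoZ) scalerBr; zmod. Qed.
Fact cdo_bracket_leibniz (D D' : cdo) (f : C) e :
  D (D' (f *: e)) - D' (D (f *: e)) =
  f *: (D (D' e) - D' (D e)) + lie_bracket (symb D) (symb D') f *: e.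
Proof.
by rewrite !(cdo_leibniz, cdoD) bracketE scalerBr scalerBl; zmod.
Qed.
Definition cdo_bracket D D' :=
  mkcdo (cdo_bracket_rlin D D') (cdo_bracket_leibniz D D').

Fact lin_rlin (f : E -> E) : linear f -> rlinear f.
Proof. by move=> fL c u v; exact: fL. Qed.
Fact lin_leibniz (f : E -> E) : linear f -> forall (a : C) e,
  f (a *: e) = a *: f e + (0 : vfield M) a *: e.
Proof. by move=> fL a e; rewrite (linZ fL) -[vf_app 0 a]/(0 : C) scale0r addr0. Qed.
Definition lin_cdo (f : E -> E) (fL : linear f) : cdo :=
  mkcdo (lin_rlin fL) (lin_leibniz fL).
End CDO.
Arguments vf_app : simpl never.
Arguments cdo_app : simpl never.

Section DER.
Variables (R : realType) (n : nat) (M : smooth_manifold R n).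
Local Notation C := (Cinfty M).
Local Notation const := (@Cconst R n M).
Variables (G1 G0 : lmodType C) (G : lie2_bundle G1 G0).
Local Notation k1 := (k1 G).
Local Notation k20 := (k20 G).
Local Notation k21 := (k21 G).
Local Notation k3 := (k3 G).

Record der0_laws (d0 : cdo G0) (d1 : cdo G1) (l : alt2 G0 G1) : Prop := Der0Laws {
  der_symb : symb d0 = symb d1;
  der_k1 : forall m, d0 (k1 m) = k1 (d1 m);
  der_k20 : forall u v, d0 (k20 u v) = k20 (d0 u) v + k20 u (d0 v) + k1 (l u v);
  der_k21 : forall u m, d1 (k21 u m) = k21 (d0 u) m + k21 u (d1 m) + l u (k1 m);
  der_k3 : forall u v w,
    l u (k20 v w) + k21 u (l v w)
    + k3 (d0 u) v w + k3 u (d0 v) w + k3 u v (d0 w)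
    = d1 (k3 u v w) + l (k20 u v) w + l v (k20 u w)
      - k21 w (l u v) + k21 v (l u w)
}.

Definition is_der0 : {pred (cdo G0 * cdo G1 * alt2 G0 G1)} := fun d =>
  `[< der0_laws d.1.1 d.1.2 d.2 >].

Let B20 := k20_bilin G.
Let B21 := k21_bilin G.
Let T3 := k3_trilin G.
Let L := bundle_laws G.
Let k2E := (bilinE B20, bilinE B21, trilinE T3).
Let k2Z := (bilinZ B20, bilinZ B21, trilinZ T3).

Fact alt2_0E u v : (0 : alt2 G0 G1) u v = 0. Proof. by []. Qed.
Fact alt2_addE (l l' : alt2 G0 G1) u v : (l + l') u v = l u v + l' u v. Proof. by []. Qed.
Fact alt2_scaleE a (l : alt2 G0 G1) u v : (a *: l) u v = a *: l u v. Proof. by []. Qed.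

Fact is_der0_closed : subsemimod_closed is_der0.
Proof.
split; [split|].
- apply/asboolP; split=> /=; rewrite ?addr0 //.
  + by move=> m; rewrite !cdo_0E linear0.
  + by move=> u v; rewrite !(cdo_0E, alt2_0E) !k2E linear0 !addr0.
  + by move=> u m; rewrite !(cdo_0E, alt2_0E) !k2E !addr0.
  + by move=> u v w; rewrite !(cdo_0E, alt2_0E) !k2E; zmod.
- move=> [[d0 d1] l] [[t0 t1] l'] /asboolP[/= a1 a2 a3 a4 a5] /asboolP[/= b1 b2 b3 b4 b5].
  apply/asboolP; split=> /=.
  + by rewrite !symbD a1 b1.
  + by move=> m; rewrite !cdo_addE a2 b2 linearD.
  + move=> u v; rewrite !(cdo_addE, alt2_addE) a3 b3 linearD /= !k2E; zmod.
  + move=> u m; rewrite !(cdo_addE, alt2_addE) a4 b4 !k2E; zmod.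
  + move=> u v w; rewrite !(cdo_addE, alt2_addE) !k2E.
    have H := addE (a5 u v w) (b5 u v w); zmodh H.
- move=> a [[d0 d1] l] /asboolP[/= a1 a2 a3 a4 a5].
  apply/asboolP; split=> /=.
  + by rewrite !symbZ a1.
  + by move=> m; rewrite !cdo_scaleE a2 linearZ.
  + by move=> u v; rewrite !(cdo_scaleE, alt2_scaleE) a3 linearZ /= !k2Z !scalerDr.
  + by move=> u m; rewrite !(cdo_scaleE, alt2_scaleE) a4 !k2Z !scalerDr.
  + move=> u v w; rewrite !(cdo_scaleE, alt2_scaleE) !k2Z.
    have H := congr1 (fun x => a *: x) (a5 u v w).
    rewrite /= !(scalerDr, scalerN) in H; zmodh H.
Qed.

Record der0 := Der0 { der0_val : cdo G0 * cdo G1 * alt2 G0 G1; der0P : der0_val \in is_der0 }.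
HB.instance Definition _ := [isSub for der0_val].
HB.instance Definition _ := [Choice of der0 by <:].
HB.instance Definition _ := GRing.SubChoice_isSubLmodule.Build
  C (cdo G0 * cdo G1 * alt2 G0 G1)%type is_der0 der0 is_der0_closed.

Definition d_0 (d : der0) : cdo G0 := (der0_val d).1.1.
Definition d_1 (d : der0) : cdo G1 := (der0_val d).1.2.
Definition d_l (d : der0) : alt2 G0 G1 := (der0_val d).2.
Lemma der0_ax (d : der0) : der0_laws (d_0 d) (d_1 d) (d_l d).
Proof. by have /asboolP := der0P d. Qed.
Lemma der0_ext (d t : der0) : d_0 d = d_0 t -> d_1 d = d_1 t -> d_l d = d_l t -> d = t.
Proof.
case: d t => [[[d0 d1] l] p] [[[t0 t1] l'] p']; rewrite /d_0 /d_1 /d_l /= => E0 E1 E2.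
by apply: val_inj; rewrite /= E0 E1 E2.
Qed.
Definition mkder0 d0 d1 l (H : der0_laws d0 d1 l) : der0 :=
  Der0 (introT (asboolP _) H : (d0, d1, l) \in is_der0).

(* DER in degree -1 *)
Definition der1 : Type := (hom G0 G1 * G0)%type.
HB.instance Definition _ := GRing.Lmodule.on der1.


Notation hD φ := (linD (hom_lin φ)).
Notation hN φ := (linN (hom_lin φ)).
Notation hZ φ := (linZ (hom_lin φ)).
Notation aE l := (bilinE (alt2_bilin l)).
Notation aZ l := (bilinZ (alt2_bilin l)).

Fact hom_addE (f g : hom G0 G1) u : (f + g) u = f u + g u. Proof. by []. Qed.
Fact hom_scaleE a (f : hom G0 G1) u : (a *: f) u = a *: f u. Proof. by []. Qed.

Fact dhom_lin (m : G1) : linear (fun u => k21 u m).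
Proof. by move=> a u v; rewrite !k2E !k2Z. Qed.
(* The Hom-component is - l2(m, .) = l2(., m). *)
Definition der_d2 (m : G1) : der1 := (mkhom (dhom_lin m), k1 m).

Lemma k3_cyc u v w : k3 u v w = k3 v w u.
Proof. by have [s12 s23] := law_skew3 L; rewrite s12 s23 opprK. Qed.

Section D1.
Variables (a : der1).
Local Notation φ := (a.1 : hom G0 G1).
Local Notation x := (a.2 : G0).
Fact d1_lin0 : linear (fun v : G0 => k1 (φ v) + k20 x v).
Proof. by move=> c u v; rewrite (hD φ) (hZ φ) linearD linearZ /= !k2E !k2Z scalerDr; zmod. Qed.
Fact d1_lin1 : linear (fun m : G1 => φ (k1 m) + k21 x m).
Proof. by move=> c u v; rewrite linearD linearZ /= (hD φ) (hZ φ) !k2E !k2Z scalerDr; zmod. Qed.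
(* l_delta(phi)(u,v) + l3(x,u,v) for a = phi + x *)
Definition d1_l (u v : G0) : G1 := φ (k20 u v) + k21 v (φ u) - k21 u (φ v) + k3 x u v.
Fact d1_l_bilin : bilin d1_l.
Proof.
split=> [u|v] c w w'; rewrite /d1_l.
  by rewrite !(k2E, k2Z, hD φ, hZ φ) !scalerDr scalerN; zmod.
by rewrite !(k2E, k2Z, hD φ, hZ φ) !scalerDr scalerN; zmod.
Qed.
Fact d1_l_skew : skew2 d1_l.
Proof.
move=> u v; have [_ s3] := law_skew3 L.
by rewrite /d1_l (law_skew2 L) s3 (hN φ); zmod.
Qed.
Fact d1_axioms : der0_laws (lin_cdo d1_lin0) (lin_cdo d1_lin1)
  (mkalt2 d1_l_bilin d1_l_skew).
Proof.
have [s12 s23] := law_skew3 L.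
split=> [//|m|u v|u m|u v w]; rewrite /cdo_app /alt2_fun /= /d1_l.
- by rewrite linearD /= (law_l1l2 L).
- rewrite !(linearD, linearN) /= !(k2E, law_l1l2 L) (law_jac0 L).
  rewrite (law_skew2 L (k1 _) v); zmod.
- rewrite (law_l1l2 L) !(k2E, law_jac1 L) (law_l2l1 L m); zmod.
- rewrite (law_jac0 L) !(hD φ, hN φ, k2E).
  have H1 := law_coh L x u v w.
  rewrite (k3_cyc (k1 _)) (s23 u (k1 _) w) !(law_jac1 L).
  zmodh H1.
Qed.
Definition der_d1 : der0 := mkder0 d1_axioms.
End D1.

Section B00.
Variables (d t : der0).
Definition b00_l (u v : G0) : G1 :=
  d_1 d (d_l t u v) - d_l t (d_0 d u) v - d_l t u (d_0 d v)
  + d_l d (d_0 t u) v + d_l d u (d_0 t v) - d_1 t (d_l d u v).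
Fact b00_l_skew : skew2 b00_l.
Proof.
move=> u v; rewrite /b00_l.
rewrite (alt2_skew (d_l t) (d_0 d u)) (alt2_skew (d_l t) u (d_0 d v)).
rewrite (alt2_skew (d_l d) (d_0 t u)) (alt2_skew (d_l d) u (d_0 t v)).
rewrite (alt2_skew (d_l d) u v) (alt2_skew (d_l t) u v) !cdoN; zmod.
Qed.
Fact b00_l_linr u : linear (b00_l u).
Proof.
move=> c w w'; rewrite /b00_l.
rewrite !(cdo_leibniz, cdoD, aE (d_l d), aZ (d_l d), aE (d_l t), aZ (d_l t)).
by rewrite !(der_symb (der0_ax _)) !(scalerDr, scalerN) ; zmod.
Qed.
Fact b00_l_bilin : bilin b00_l.
Proof.
split=> [u|v]; first exact: b00_l_linr.
move=> c w w'; rewrite b00_l_skew b00_l_linr !(b00_l_skew _ v) scalerN; zmod.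
Qed.
Fact b00_axioms : der0_laws (cdo_bracket (d_0 d) (d_0 t))
  (cdo_bracket (d_1 d) (d_1 t)) (mkalt2 b00_l_bilin b00_l_skew).
Proof.
have [d1 d2 d3 d4 d5] := der0_ax d.
have [t1 t2 t3 t4 t5] := der0_ax t.
split=> [|m|u v|u m|u v w].
- by rewrite /symb /= -!/(symb _) d1 t1.
- by rewrite /cdo_app /= -!/(cdo_app _ _) !(d2, t2) linearD linearN.
- rewrite /cdo_app /alt2_fun /= -!/(cdo_app _ _) /b00_l.
  rewrite !(d3, t3, cdoD, d2, t2, linearD, linearN, k2E) /=; zmod.
- rewrite /cdo_app /alt2_fun /= -!/(cdo_app _ _) /b00_l.
  rewrite !(d4, t4, cdoD, d2, t2, k2E, aE (d_l d), aE (d_l t)) /=; zmod.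
- rewrite /cdo_app /alt2_fun /= -!/(cdo_app _ _) /b00_l.
  have HA := addE (addE (addE (congr1 (d_1 d) (t5 u v w)) (d5 (d_0 t u) v w))
    (d5 u (d_0 t v) w)) (d5 u v (d_0 t w)).
  have HB := addE (addE (addE (congr1 (d_1 t) (d5 u v w)) (t5 (d_0 d u) v w))
    (t5 u (d_0 d v) w)) (t5 u v (d_0 d w)).
  have H := addE HA (esym HB).
  rewrite !(cdoD, cdoN, d4, t4) in H.
  rewrite !(d3, t3, cdoD, cdoN, k2E, aE (d_l d), aE (d_l t)).
  rewrite (alt2_skew (d_l d) (k1 _)) (alt2_skew (d_l t) (k1 _)).
  zmodh H.
Qed.
Definition der_b00 : der0 := mkder0 b00_axioms.
End B00.

Section B01.
Variables (d : der0) (a : der1).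
Local Notation φ := (a.1 : hom G0 G1).
Local Notation x := (a.2 : G0).
Fact b01_lin : linear (fun v : G0 => d_1 d (φ v) - φ (d_0 d v) + d_l d x v).
Proof.
move=> c u v.
rewrite !(cdo_leibniz, cdoD, hD φ, hZ φ, aE (d_l d), aZ (d_l d)).
by rewrite (der_symb (der0_ax _)) !(scalerDr, scalerN); zmod.
Qed.
Definition der_b01 : der1 := (mkhom b01_lin, d_0 d x).
End B01.

Definition der_b02 (d : der0) (m : G1) : G1 := d_1 d m.
Definition der_b11 (a b : der1) : G1 := (a.1 : hom G0 G1) b.2 + (b.1 : hom G0 G1) a.2.
Definition der_rho (d : der0) : vfield M := symb (d_0 d).

Fact der_rho_linear : linear der_rho. Proof. by []. Qed.
Fact der_d2_linear : linear der_d2.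
Proof.
move=> c m p; congr pair; last by rewrite linearP.
by apply: hom_ext => u; rewrite hom_addE hom_scaleE /hom_fun /= !k2E !k2Z.
Qed.
Fact der_d1_linear : linear der_d1.
Proof.
move=> c [φ x] [ψ y]; apply: der0_ext.
- apply: cdo_ext; last by apply: vf_ext => f; rewrite -[RHS]/(c * 0 + 0 : C) mulr0 addr0.
  move=> u; rewrite -[LHS]/(k1 ((c *: φ + ψ) u) + k20 (c *: x + y) u).
  rewrite -[RHS]/(c *: (k1 (φ u) + k20 x u) + (k1 (ψ u) + k20 y u)).
  rewrite hom_addE hom_scaleE linearD linearZ /= !k2E !k2Z scalerDr; zmod.
- apply: cdo_ext; last by apply: vf_ext => f; rewrite -[RHS]/(c * 0 + 0 : C) mulr0 addr0.
  move=> m; rewrite -[LHS]/((c *: φ + ψ) (k1 m) + k21 (c *: x + y) m).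
  rewrite -[RHS]/(c *: (φ (k1 m) + k21 x m) + (ψ (k1 m) + k21 y m)).
  rewrite hom_addE hom_scaleE !k2E !k2Z scalerDr; zmod.
- apply: alt2_ext => u v; rewrite -[LHS]/(d1_l (c *: φ + ψ, c *: x + y) u v).
  rewrite -[RHS]/(c *: d1_l (φ, x) u v + d1_l (ψ, y) u v) /d1_l /=.
  rewrite !hom_addE !hom_scaleE !k2E !k2Z !scalerDr scalerN; zmod.
Qed.
HB.instance Definition _ := GRing.isLinear.Build C der0 (vfield M) *:%R der_rho der_rho_linear.
HB.instance Definition _ := GRing.isLinear.Build C G1 der1 *:%R der_d2 der_d2_linear.
HB.instance Definition _ := GRing.isLinear.Build C der1 der0 *:%R der_d1 der_d1_linear.

Fact d0_addE (d t : der0) : d_0 (d + t) = d_0 d + d_0 t. Proof. by []. Qed.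
Fact d1_addE (d t : der0) : d_1 (d + t) = d_1 d + d_1 t. Proof. by []. Qed.
Fact dl_addE (d t : der0) : d_l (d + t) = d_l d + d_l t. Proof. by []. Qed.
Fact d0_scaleE a (d : der0) : d_0 (a *: d) = a *: d_0 d. Proof. by []. Qed.
Fact d1_scaleE a (d : der0) : d_1 (a *: d) = a *: d_1 d. Proof. by []. Qed.
Fact dl_scaleE a (d : der0) : d_l (a *: d) = a *: d_l d. Proof. by []. Qed.
Fact d0_oppE (d : der0) : d_0 (- d) = - d_0 d. Proof. by []. Qed.
Let d_addE := (d0_addE, d1_addE, dl_addE, d0_scaleE, d1_scaleE, dl_scaleE,
  @cdo_addE R n M G0, @cdo_addE R n M G1, @cdo_scaleE R n M G0, @cdo_scaleE R n M G1,
  alt2_addE, alt2_scaleE).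

Fact b00_0 d t u : d_0 (der_b00 d t) u = d_0 d (d_0 t u) - d_0 t (d_0 d u). Proof. by []. Qed.
Fact b00_1 d t m : d_1 (der_b00 d t) m = d_1 d (d_1 t m) - d_1 t (d_1 d m). Proof. by []. Qed.
Fact b00_2 d t u v : d_l (der_b00 d t) u v = b00_l d t u v. Proof. by []. Qed.
Fact b00_s d t : symb (d_0 (der_b00 d t)) = lie_bracket (symb (d_0 d)) (symb (d_0 t)). Proof. by []. Qed.
Fact b00_s1 d t : symb (d_1 (der_b00 d t)) = lie_bracket (symb (d_1 d)) (symb (d_1 t)). Proof. by []. Qed.
Let b00E := (b00_0, b00_1, b00_2).

Lemma der0_ext' (d t : der0) : symb (d_0 d) = symb (d_0 t) ->
  (forall u, d_0 d u = d_0 t u) -> (forall m, d_1 d m = d_1 t m) ->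
  (forall u v, d_l d u v = d_l t u v) -> d = t.
Proof.
move=> s e0 e1 e2; apply: der0_ext.
- exact: cdo_ext.
- by apply: cdo_ext => //; rewrite -!(der_symb (der0_ax _)).
- exact: alt2_ext.
Qed.

Fact der_b00_skew : skew2 der_b00.
Proof.
move=> d t; apply: der0_ext'.
- by rewrite -[RHS]/(- lie_bracket (symb (d_0 t)) (symb (d_0 d))) b00_s bracket_skew.
- by move=> u; rewrite -[RHS]/(- (d_0 t (d_0 d u) - d_0 d (d_0 t u))) b00_0; zmod.
- by move=> u; rewrite -[RHS]/(- (d_1 t (d_1 d u) - d_1 d (d_1 t u))) b00_1; zmod.
- by move=> u v; rewrite -[RHS]/(- b00_l t d u v) b00_2 /b00_l; zmod.
Qed.

Fact der_b00_linr d (c : C) t t' :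
  der_b00 d (c *: t + t') = c *: der_b00 d t + der_b00 d t' + symb (d_0 d) c *: t.
Proof.
apply: der0_ext'.
- rewrite b00_s !d_addE !symbD !symbZ !b00_s.
  by have := bracket_leibniz (symb (d_0 d)) c (symb (d_0 t)); rewrite /= => E; rewrite (rbilinDr (@bracket_rbilin R n M)) E; zmod.
- move=> u; rewrite !(b00E, d_addE) ?b00E ?d_addE !(cdoD, cdo_leibniz) scalerBr; zmod.
- move=> u; rewrite !(b00E, d_addE) ?b00E ?d_addE !(cdoD, cdo_leibniz) scalerBr (der_symb (der0_ax d)); zmod.
- move=> u v; rewrite !(b00E, d_addE) ?b00E /b00_l.
  rewrite !d_addE !(cdoD, cdo_leibniz, aE (d_l d), aZ (d_l d)) (der_symb (der0_ax d)) !(scalerDr, scalerN); zmod.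
Qed.
Fact der_b00_leibniz d (c : C) t :
  der_b00 d (c *: t) = c *: der_b00 d t + der_rho d c *: t.
Proof.
have z : der_b00 d 0 = 0.
  apply: (@addrI _ (der_b00 d 0)); have := der_b00_linr d 1 0 0.
  by rewrite !scale1r scaler0 !addr0 => <-.
by have := der_b00_linr d c t 0; rewrite z !addr0.
Qed.
Fact der_b00_rbilin : rbilin der_b00.
Proof.
have r d : rlinear (der_b00 d).
  by move=> c t t'; rewrite der_b00_linr vf_const scale0r addr0.
split=> [//|t] c d d'.
by rewrite der_b00_skew r !(der_b00_skew _ t) scalerN; zmod.
Qed.

Lemma der1_ext (a b : der1) : (forall u, (a.1 : hom G0 G1) u = (b.1 : hom G0 G1) u) ->
  a.2 = b.2 -> a = b.
Proof. by case: a b => [f x] [g y] /= fg ->; congr pair; exact: hom_ext. Qed.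

Fact b01_1 d (a : der1) u : ((der_b01 d a).1 : hom G0 G1) u =
  d_1 d ((a.1 : hom G0 G1) u) - (a.1 : hom G0 G1) (d_0 d u) + d_l d a.2 u.
Proof. by []. Qed.
Fact b01_2 d (a : der1) : (der_b01 d a).2 = d_0 d a.2. Proof. by []. Qed.
Let b01E := (b01_1, b01_2).
Fact pair1_addE (a b : der1) u : ((a + b).1 : hom G0 G1) u = (a.1 : hom G0 G1) u + (b.1 : hom G0 G1) u.
Proof. by []. Qed.
Fact pair1_scaleE c (a : der1) u : ((c *: a).1 : hom G0 G1) u = c *: (a.1 : hom G0 G1) u.
Proof. by []. Qed.
Fact pair2_addE (a b : der1) : (a + b).2 = a.2 + b.2. Proof. by []. Qed.
Fact pair2_scaleE c (a : der1) : (c *: a).2 = c *: a.2. Proof. by []. Qed.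
Let pE := (pair1_addE, pair1_scaleE, pair2_addE, pair2_scaleE).

Fact der_b01_linr d (c : C) a b :
  der_b01 d (c *: a + b) = c *: der_b01 d a + der_b01 d b + symb (d_0 d) c *: a.
Proof.
apply: der1_ext => [u|]; rewrite !(b01E, pE) ?b01E.
  rewrite ?pE !(cdoD, cdo_leibniz, aE (d_l d), aZ (d_l d)) (der_symb (der0_ax d)).
  rewrite !(scalerDr, scalerN); zmod.
by rewrite cdoD cdo_leibniz; zmod.
Qed.
Fact der_b01_linl (c : C) d d' a :
  der_b01 (c *: d + d') a = c *: der_b01 d a + der_b01 d' a.
Proof.
apply: der1_ext => [u|]; rewrite !(b01E, pE, d_addE) ?b01E.
  rewrite !(linD (hom_lin _), linZ (hom_lin _)) !(scalerDr, scalerN); zmod.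
done.
Qed.
Fact der_b01_leibniz d (c : C) a :
  der_b01 d (c *: a) = c *: der_b01 d a + der_rho d c *: a.
Proof.
have z : der_b01 d 0 = 0.
  apply: (@addrI _ (der_b01 d 0)); have := der_b01_linr d 1 0 0.
  by rewrite !scale1r scaler0 !addr0 => <-.
by have := der_b01_linr d c a 0; rewrite z !addr0.
Qed.
Fact der_b01_linl' (c : C) d a : der_b01 (c *: d) a = c *: der_b01 d a.
Proof. by have := linZ (fun c d d' => der_b01_linl c d d' a) c d. Qed.
Fact der_b01_rbilin : rbilin der_b01.
Proof.
split=> [d|a] c t t'; last exact: der_b01_linl.
by rewrite der_b01_linr vf_const scale0r addr0.
Qed.

Fact der_b02_rbilin : rbilin der_b02.
Proof. by split=> [d|m] c t t'; rewrite /der_b02 ?(cdo_rlin (d_1 d)). Qed.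
Fact der_b02_leibniz d (c : C) m :
  der_b02 d (c *: m) = c *: der_b02 d m + der_rho d c *: m.
Proof. by rewrite /der_b02 cdo_leibniz /der_rho (der_symb (der0_ax d)). Qed.
Fact der_b02_linl (c : C) d m : der_b02 (c *: d) m = c *: der_b02 d m.
Proof. by []. Qed.

Fact der_b11_bilin : bilin der_b11.
Proof.
split=> [a|b] c t t'; rewrite /der_b11 !pE !(linD (hom_lin _), linZ (hom_lin _)) scalerDr; zmod.
Qed.
Fact der_b11_sym a b : der_b11 a b = der_b11 b a.
Proof. by rewrite /der_b11 addrC. Qed.

Fact dd1_0 (a : der1) u : d_0 (der_d1 a) u = k1 ((a.1 : hom G0 G1) u) + k20 a.2 u. Proof. by []. Qed.
Fact dd1_1 (a : der1) m : d_1 (der_d1 a) m = (a.1 : hom G0 G1) (k1 m) + k21 a.2 m. Proof. by []. Qed.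
Fact dd1_2 (a : der1) u v : d_l (der_d1 a) u v = d1_l a u v. Proof. by []. Qed.
Fact dd1_s (a : der1) : symb (d_0 (der_d1 a)) = 0. Proof. by []. Qed.
Fact dd2_1 m u : ((der_d2 m).1 : hom G0 G1) u = k21 u m. Proof. by []. Qed.
Fact dd2_2 m : (der_d2 m).2 = k1 m. Proof. by []. Qed.
Let ddE := (dd1_0, dd1_1, dd1_2, dd2_1, dd2_2).

Fact der_dd m : der_d1 (der_d2 m) = 0.
Proof.
apply: der0_ext' => [//|u|p|u v]; rewrite !ddE.
- by rewrite (law_l1l2 L) (law_skew2 L) addNr.
- by rewrite (law_l2l1 L) addNr.
- rewrite /d1_l !ddE (k3_cyc (k1 m)) (law_jac1 L) -[alt2_fun _ _ _]/(0 : G1); zmod.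
Qed.

Fact der_der01 d a : der_d1 (der_b01 d a) = der_b00 d (der_d1 a).
Proof.
have [e1 e2 e3 e4 e5] := der0_ax d.
apply: der0_ext' => [|u|m|u v]; rewrite ?b00_s ?dd1_s ?bracket0r //.
- rewrite !(ddE, b00E, b01E) ?ddE !(linearD, linearN) /= !(cdoD, e2, e3); zmod.
- rewrite !(ddE, b00E, b01E) ?ddE !(cdoD, e4) e2; zmod.
- rewrite !(ddE, b00E) /d1_l /b00_l !ddE /d1_l !b01E.
  rewrite !(cdoD, cdoN, e3, e4, k2E, linD (hom_lin _), aE (d_l d)).
  rewrite (alt2_skew (d_l d) (k1 _)).
  have H := e5 a.2 u v; zmodh H.
Qed.
Fact der_der02 d m : der_d2 (der_b02 d m) = der_b01 d (der_d2 m).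
Proof.
have [e1 e2 e3 e4 e5] := der0_ax d.
apply: der1_ext => [u|]; rewrite !(ddE, b01E) /der_b02 ?ddE.
  by rewrite e4 (alt2_skew (d_l d) (k1 m)); zmod.
by rewrite e2.
Qed.
Fact der_der11 a b : der_d2 (der_b11 a b) = der_b01 (der_d1 a) b + der_b01 (der_d1 b) a.
Proof.
have [s12 s23] := law_skew3 L.
apply: der1_ext => [u|]; rewrite !(ddE, b01E, pE) /der_b11 ?ddE !(linearD, k2E) /=.
  rewrite ?b01E ?ddE /d1_l !(linD (hom_lin _)) (s12 b.2 a.2); zmod.
rewrite ?b01_2 ?ddE (law_skew2 L b.2); zmod.
Qed.
Fact der_der12 a m : der_b02 (der_d1 a) m = der_b11 a (der_d2 m).
Proof. by rewrite /der_b02 /der_b11 !ddE. Qed.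

Fact der_jac000 x y z :
  der_b00 x (der_b00 y z) = der_b00 (der_b00 x y) z + der_b00 y (der_b00 x z).
Proof.
apply: der0_ext' => [|u|m|u v].
- by rewrite !d0_addE symbD !b00_s bracket_jacobi.
- rewrite !(d_addE, b00E) !(cdoD, cdoN, b00E); zmod.
- rewrite !(d_addE, b00E) !(cdoD, cdoN, b00E); zmod.
- rewrite !(d_addE, b00E) /b00_l !b00E /b00_l.
  rewrite !(cdoD, cdoN, aE (d_l x), aE (d_l y), aE (d_l z)); zmod.
Qed.
Fact der_jac001 x y a :
  der_b01 x (der_b01 y a) = der_b01 (der_b00 x y) a + der_b01 y (der_b01 x a).
Proof.
apply: der1_ext => [u|]; rewrite !(pE, b01E, b00E) ?b01E ?b00E.
  rewrite /b00_l !(cdoD, cdoN, linD (hom_lin _), linN (hom_lin _)).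
  rewrite (alt2_skew (d_l x) _ (d_0 y u)); zmod.
zmod.
Qed.
Fact der_jac002 x y m :
  der_b02 x (der_b02 y m) = der_b02 (der_b00 x y) m + der_b02 y (der_b02 x m).
Proof. by rewrite /der_b02 b00_1; zmod. Qed.
Fact der_jac011 x a b :
  der_b02 x (der_b11 a b) = der_b11 (der_b01 x a) b + der_b11 a (der_b01 x b).
Proof.
rewrite /der_b02 /der_b11 !b01E cdoD (alt2_skew (d_l x) b.2); zmod.
Qed.

Definition DER : strict_lie3 G1 der1 der0 :=
  @StrictLie3 R n M G1 der1 der0 der_rho der_d2 der_d1 der_b00 der_b01 der_b02 der_b11
    der_b00_rbilin der_b01_rbilin der_b02_rbilin der_b11_bilin der_b00_skew der_b11_sym
    der_dd der_der01 der_der02 der_der11 der_der12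
    der_jac000 der_jac001 der_jac002 der_jac011
    der_b00_leibniz der_b01_leibniz der_b02_leibniz der_b01_linl' der_b02_linl.
End DER.

Section Splitting.
Variables (R : realType) (n : nat) (M : smooth_manifold R n).
Local Notation C := (Cinfty M).
Variables (S1 S0 : lmodType C) (A : lie2_algebroid_on S1 S0).

Record splitting := Splitting {
  sigma : {linear vfield M -> S0};
  gamma : vfield M -> vfield M -> S1;
  sigmaK : forall X, rho A (sigma X) = X;
  gamma_bilin : bilin gamma;
  gamma_skew : skew2 gamma
}.

Variable s : splitting.
Implicit Types X Y Z : vfield M.

Definition nabla0 X (u : S0) : S0 := l20 A (sigma s X) u.
Definition nabla1 X (m : S1) : S1 := l21 A (sigma s X) m.

(* d_nabla on 2-forms *)
Definition dnabla (V : lmodType C) (nabla : vfield M -> V -> V)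
    (theta : vfield M -> vfield M -> V) X Y Z : V :=
  nabla X (theta Y Z) - nabla Y (theta X Z) + nabla Z (theta X Y)
  - theta (lie_bracket X Y) Z + theta (lie_bracket X Z) Y
  - theta (lie_bracket Y Z) X.

Definition curvR X Y : S0 :=
  sigma s (lie_bracket X Y) - l20 A (sigma s X) (sigma s Y) - l1 A (gamma s X Y).
Definition curvI X Y Z : S1 :=
  - dnabla nabla1 (gamma s) X Y Z - l3 A (sigma s X) (sigma s Y) (sigma s Z).
Definition curvJ X Y (u : S0) : S1 := - l3 A (sigma s X) (sigma s Y) u.
Definition curvK X (u v : S0) : S1 := l3 A (sigma s X) u v.
Definition curvR_gamma X Y : S0 := curvR X Y + l1 A (gamma s X Y).
Definition curvI_gamma X Y Z : S1 :=
  curvI X Y Z + dnabla nabla1 (gamma s) X Y Z.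
End Splitting.

Section OverManifold.
Variables (R : realType) (n : nat) (M : smooth_manifold R n).

Definition lie2_algebroid (Am1 A0 : vector_bundle M) : Type :=
  lie2_algebroid_on (section Am1) (section A0).

Definition transitive_lie2 (Am1 A0 : vector_bundle M)
    (A : lie2_algebroid Am1 A0) : Prop :=
  forall X : vfield M, exists a : section A0, rho A a = X.
End OverManifold.

(* Main.v *)
Require Import Defs.
From HB Require Import structures.
From mathcomp Require Import all_boot all_order all_algebra.
From mathcomp Require Import boolp reals.
Set Implicit Arguments.
Unset Strict Implicit.
Unset Printing Implicit Defensive.
Import GRing.Theory.
Local Open Scope ring_scope.

(** Every section x of A_0 acts on the isotropy bundle ker rho by the derivation
  ad x = (l2(x, .), l2(x, .), l3(x, ., .)): the derivation axioms are the Jacobi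
  identities and the coherence law of A with x in one slot.  The map ad is not a
  morphism of brackets: ad (l2(x, y)) and [ad x, ad y] differ by the
  differential of - l3(x, y, .), so l3 supplies the homotopies.

  A splitting pulls this action back along sigma : TM -> A_0.  Besides the
  failure of ad, there is now the failure of sigma,
      sigma [X, Y] = l2(sigma X, sigma Y) + R_gamma(X, Y),
  where R_gamma takes values in ker rho because both brackets lie over [X, Y].
  The term gamma cancels in R_gamma and in I_gamma, and
  I_gamma = - l3(sigma, sigma, sigma).

  The three morphism equations then become identities of A.  Equation 2 is the
  defect formula for ad ([ad_der_bracket_defect]) with correction R_gamma.  In
  equation 3 all terms containing some sigma [X, Y] cancel cyclically, by
  skew-symmetry and the Jacobi identity of vector fields; what is left is the
  cyclic form of the Jacobi identity and of the coherence law ([l3_jacobi_cyc],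
  [l3_coh_cyc]).  In equation 4 the factor 1/2 compensates that each pair
  partition {ij|kl} occurs twice; the two occurrences together lose their
  sigma [X_i, X_j] terms, and the sum over the three partitions completes the
  four action terms to the coherence law at sigma X_1, ..., sigma X_4. *)

(** * The action of A_0 on the isotropy bundle *)

Section IsotropyRestriction.
Variables (R : realType) (n : nat) (M : smooth_manifold R n).
Local Notation C := (Cinfty M).
Variables (S1 S0 : lmodType C) (A : lie2_algebroid_on S1 S0).
Local Notation G := (kermod (rho A)).
Local Notation kv := (@ker_val _ _ _ (rho A)).
Implicit Types (x y z : S0) (m : S1) (u v w : G).

Let L := algebroid_laws A.
Let B0 := l20_rbilin A.
Let B1 := l21_rbilin A.
Let T3 := l3_trilin A.

Lemma l3_skew12 x y z : l3 A x y z = - l3 A y x z.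
Proof. by case: (law_skew3 L). Qed.

Lemma l3_skew23 x y z : l3 A x y z = - l3 A x z y.
Proof. by case: (law_skew3 L). Qed.

Lemma l3_rot x y z : l3 A x y z = l3 A y z x.
Proof. by rewrite l3_skew12 l3_skew23 opprK. Qed.

Lemma l3_jacobi_cyc x y z :
  l1 A (l3 A x y z) = l20 A x (l20 A y z) + l20 A y (l20 A z x) + l20 A z (l20 A x y).
Proof.
rewrite (law_jac0 L) (law_skew2 L (l20 A x y)) (law_skew2 L x z) (rbilinNr B0).
by zmod.
Qed.

(** The coherence law is symmetric in its four arguments up to sign; singling out
  one of them groups the remaining terms into three cyclic copies. *)
Lemma l3_coh_cyc x y z t :
    (l21 A x (l3 A y z t) - l3 A y z (l20 A x t) + l3 A x (l20 A y z) t)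
    + (l21 A y (l3 A z x t) - l3 A z x (l20 A y t) + l3 A y (l20 A z x) t)
    + (l21 A z (l3 A x y t) - l3 A x y (l20 A z t) + l3 A z (l20 A x y) t) =
  l21 A t (l3 A x y z).
Proof.
have E := law_coh L x y z t.
rewrite (l3_skew12 (l20 A x y)) in E.
rewrite (law_skew2 L z x) !(l3_skew12 z x) !(trilinE T3, rbilinE B1).
by zmodh E.
Qed.

Definition ad0 x u : G := mkker (rho_l2_ker x u).

Lemma ad0_rlinear x : rlinear (ad0 x).
Proof. by move=> c u v; apply: ker_ext; exact: B0.1. Qed.

Lemma ad0_leibniz x (f : C) u : ad0 x (f *: u) = f *: ad0 x u + rho A x f *: u.
Proof. by apply: ker_ext; exact: l20_leibniz. Qed.

(** The Leibniz term of l2 in its left argument is - rho(u)(f) x, which vanishes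
  on the isotropy; hence x |-> ad x will be a bundle map. *)
Lemma ad0_linear_l u : linear (ad0^~ u).
Proof.
move=> f x y; apply: ker_ext => /=.
by rewrite (rbilinDl B0) l20_leibniz_l ker0 scale0r subr0.
Qed.

Definition ad0_cdo x : cdo G := mkcdo (@ad0_rlinear x) (@ad0_leibniz x).

Definition ad1_cdo x : cdo S1 := mkcdo (B1.1 x) (@l21_leibniz _ _ _ _ _ A x).

Lemma l21_linear_l m : linear (l21 A ^~ m).
Proof. by move=> f x y; rewrite (rbilinDl B1) l21_linl. Qed.

Lemma l3_ker_bilin x : bilin (fun u v => l3 A x (kv u) (kv v)).
Proof. by case: T3 => h1 h2 h3; split=> [u|v] a y z; [exact: h1|exact: h2]. Qed.

Lemma l3_ker_skew x : skew2 (fun u v => l3 A x (kv u) (kv v)).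
Proof. by move=> u v; exact: l3_skew23. Qed.

Definition ad2 x : alt2 G S1 := mkalt2 (@l3_ker_bilin x) (@l3_ker_skew x).

(** The conditions on the triple are respectively l1 l2 = l2 l1, the two Jacobi
  identities, and the coherence law, with x as the distinguished argument. *)
Lemma ad_der0_laws x :
  @der0_laws R n M S1 G (isotropy A) (ad0_cdo x) (ad1_cdo x) (ad2 x).
Proof.
split=> [//|m|u v|u m|u v w].
- by apply: ker_ext; rewrite /= (law_l1l2 L).
- apply: ker_ext.
  have H : l20 A x (l20 A (kv u) (kv v)) = l20 A (l20 A x (kv u)) (kv v)
      + l20 A (kv u) (l20 A x (kv v)) + l1 A (l3 A x (kv u) (kv v)).
    by rewrite (law_jac0 L); zmod.
  exact: H.
- have H : l21 A x (l21 A (kv u) m) = l21 A (l20 A x (kv u)) m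
      + l21 A (kv u) (l21 A x m) + l3 A x (kv u) (l1 A m).
    by rewrite (law_jac1 L); zmod.
  exact: H.
- have H : l3 A x (kv u) (l20 A (kv v) (kv w)) + l21 A (kv u) (l3 A x (kv v) (kv w))
    + l3 A (l20 A x (kv u)) (kv v) (kv w) + l3 A (kv u) (l20 A x (kv v)) (kv w)
    + l3 A (kv u) (kv v) (l20 A x (kv w))
    = l21 A x (l3 A (kv u) (kv v) (kv w)) + l3 A x (l20 A (kv u) (kv v)) (kv w)
      + l3 A x (kv v) (l20 A (kv u) (kv w))
      - l21 A (kv w) (l3 A x (kv u) (kv v)) + l21 A (kv v) (l3 A x (kv u) (kv w)).
    by have E := law_coh L x (kv u) (kv v) (kv w); zmodh E.
  exact: H.
Qed.

Definition ad_der x : der0 (isotropy A) := mkder0 (ad_der0_laws x).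

Lemma ad_der_linear : linear ad_der.
Proof.
have [_ _ h3] := T3.
move=> f x y; apply: der0_ext'.
- exact: (linearP (rho A)).
- by move=> u; exact: ad0_linear_l.
- by move=> m; exact: l21_linear_l.
- by move=> u v; exact: h3.
Qed.
HB.instance Definition _ := GRing.isLinear.Build C S0 (der0 (isotropy A)) *:%R
  ad_der ad_der_linear.

Lemma l3_ker_linear x y : linear (fun u => l3 A x y (kv u)).
Proof. by case: T3 => h1 _ _ a u v; exact: h1. Qed.

Definition l3_hom x y : Defs.hom G S1 := mkhom (@l3_ker_linear x y).

(** The homotopy between ad of a bracket and the bracket of ad is - l3(x, y, .).
  The bracket may be corrected by an isotropy element r, since the
  differential of r in degree -1 is exactly ad r; this is the freedom needed
  for a section sigma that does not preserve brackets. *)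
Lemma ad_der_bracket_defect x y (r : G) z : z = l20 A x y + kv r ->
  ad_der z - der_b00 (ad_der x) (ad_der y) =
  der_d1 (isotropy A) (- l3_hom x y, r).
Proof.
move=> ->; apply: der0_ext'.
- have -> : symb (d_0 (der_d1 (isotropy A) (- l3_hom x y, r))) = 0 by [].
  rewrite -[LHS]/(rho A (l20 A x y + kv r) - lie_bracket (rho A x) (rho A y)).
  by rewrite linearD /= ker0 rho_l2 addr0 subrr.
- move=> u; apply: ker_ext.
  rewrite -[LHS]/(l20 A (l20 A x y + kv r) (kv u)
    - (l20 A x (l20 A y (kv u)) - l20 A y (l20 A x (kv u)))).
  rewrite -[RHS]/(l1 A (- l3 A x y (kv u)) + l20 A (kv r) (kv u)).
  by rewrite linearN /= (law_jac0 L) (rbilinDl B0); zmod.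
- move=> m.
  rewrite -[LHS]/(l21 A (l20 A x y + kv r) m
    - (l21 A x (l21 A y m) - l21 A y (l21 A x m))).
  rewrite -[RHS]/(- l3 A x y (l1 A m) + l21 A (kv r) m).
  by rewrite (law_jac1 L) (rbilinDl B1); zmod.
- move=> u v.
  rewrite -[LHS]/(l3 A (l20 A x y + kv r) (kv u) (kv v)
    - (l21 A x (l3 A y (kv u) (kv v)) - l3 A y (l20 A x (kv u)) (kv v)
       - l3 A y (kv u) (l20 A x (kv v)) + l3 A x (l20 A y (kv u)) (kv v)
       + l3 A x (kv u) (l20 A y (kv v)) - l21 A y (l3 A x (kv u) (kv v)))).
  rewrite -[RHS]/(- l3 A x y (l20 A (kv u) (kv v))
    + l21 A (kv v) (- l3 A x y (kv u)) - l21 A (kv u) (- l3 A x y (kv v))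
    + l3 A (kv r) (kv u) (kv v)).
  have H := law_coh L x y (kv u) (kv v).
  by rewrite !(trilinE T3, rbilinE B1); zmodh H.
Qed.

End IsotropyRestriction.

(** * The morphism defined by a splitting *)

Section SplittingMorphism.
Variables (R : realType) (n : nat) (M : smooth_manifold R n).
Local Notation C := (Cinfty M).
Variables (S1 S0 : lmodType C) (A : lie2_algebroid_on S1 S0) (s : splitting A).
Local Notation G := (kermod (rho A)).
Local Notation kv := (@ker_val _ _ _ (rho A)).
Local Notation sg := (sigma s).
Local Notation "[ X ,, Y ]" := (lie_bracket X Y) (at level 0).
Implicit Types (X Y Z W : vfield M) (u : G).

Let L := algebroid_laws A.
Let B0 := l20_rbilin A.
Let B1 := l21_rbilin A.
Let T3 := l3_trilin A.

Lemma curvR_gammaE X Y : curvR_gamma s X Y = sg [X ,, Y] - l20 A (sg X) (sg Y).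
Proof. by rewrite /curvR_gamma /curvR; zmod. Qed.

Lemma curvI_gammaE X Y Z : curvI_gamma s X Y Z = - l3 A (sg X) (sg Y) (sg Z).
Proof. by rewrite /curvI_gamma /curvI; zmod. Qed.

(** The G_0-component of F^2 has to be a section of the isotropy ker rho. *)
Lemma rho_curvR_gamma X Y : rho A (curvR_gamma s X Y) = 0.
Proof. by rewrite curvR_gammaE linearB /= rho_l2 !sigmaK subrr. Qed.

Lemma sigma_bracket X Y : sg [X ,, Y] = l20 A (sg X) (sg Y) + curvR_gamma s X Y.
Proof. by rewrite curvR_gammaE; zmod. Qed.

Lemma curvR_gamma_skew : skew2 (curvR_gamma s).
Proof.
move=> X Y; rewrite !curvR_gammaE bracket_skew linearN (law_skew2 L); zmod.
Qed.

(** Both brackets in R_gamma obey the Leibniz rule with the same derivative X f,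
  so the two derivative terms X(f) sigma Y cancel. *)
Lemma curvR_gamma_linear_r X : linear (curvR_gamma s X).
Proof.
move=> f Y Z; rewrite !curvR_gammaE (rbilinDr (@bracket_rbilin R n M)).
rewrite bracket_leibniz !linearD !linearZ /= (rbilinDr B0) l20_leibniz sigmaK.
by rewrite scalerN; zmod.
Qed.

Lemma curvR_gamma_bilin : bilin (curvR_gamma s).
Proof.
split=> [X|Y] f Z W; first exact: curvR_gamma_linear_r.
by rewrite 3!(curvR_gamma_skew _ Y) curvR_gamma_linear_r scalerN; zmod.
Qed.

Definition split_F1 : {linear vfield M -> der0 (isotropy A)} := @ad_der R n M S1 S0 A \o sg.

Definition split_F2 X Y : der1 S1 G :=
  (- l3_hom A (sg X) (sg Y), mkker (rho_curvR_gamma X Y)).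

Definition split_F3 X Y Z : S1 := curvI_gamma s X Y Z.

Lemma split_F2_bilin : bilin split_F2.
Proof.
have [_ h2 h3] := T3; have [r1 r2] := curvR_gamma_bilin.
split=> [X|Y] f Z W; (apply: der1_ext => [u|]; [|apply: ker_ext]).
- rewrite -[LHS]/(- l3 A (sg X) (sg (f *: Z + W)) (kv u)).
  rewrite -[RHS]/(f *: - l3 A (sg X) (sg Z) (kv u) - l3 A (sg X) (sg W) (kv u)).
  by rewrite linearP /= h2 scalerN; zmod.
- exact: r1.
- rewrite -[LHS]/(- l3 A (sg (f *: Z + W)) (sg Y) (kv u)).
  rewrite -[RHS]/(f *: - l3 A (sg Z) (sg Y) (kv u) - l3 A (sg W) (sg Y) (kv u)).
  by rewrite linearP /= h3 scalerN; zmod.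
- exact: r2.
Qed.

Lemma split_F2_skew : skew2 split_F2.
Proof.
move=> X Y; apply: der1_ext => [u|].
- rewrite -[LHS]/(- l3 A (sg X) (sg Y) (kv u)).
  by rewrite -[RHS]/(- - l3 A (sg Y) (sg X) (kv u)) l3_skew12.
- by apply: ker_ext; exact: curvR_gamma_skew.
Qed.

Lemma split_F3_trilin : trilin split_F3.
Proof.
have [h1 h2 h3] := T3.
split=> [X Y|X Z|Y Z] f V W;
  by rewrite /split_F3 !curvI_gammaE linearP /= ?h1 ?h2 ?h3 scalerN; zmod.
Qed.

Lemma split_F3_skew : skew3 split_F3.
Proof.
split=> X Y Z; rewrite /split_F3 !curvI_gammaE; congr (- _).
- exact: l3_skew12.
- exact: l3_skew23.
Qed.

Lemma split_eq2 X Y : split_F1 [X ,, Y] - der_b00 (split_F1 X) (split_F1 Y) =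
  der_d1 (isotropy A) (split_F2 X Y).
Proof. exact/ad_der_bracket_defect/sigma_bracket. Qed.

(** The equation is checked on the two parts Hom(G_0, G_-1) and G_0 of degree -1:
  on the first it is the cyclic coherence law, on the second the cyclic Jacobi
  identity, once the terms with sigma [X, Y] have cancelled. *)
Lemma split_eq3 X Y Z :
    (der_b01 (split_F1 X) (split_F2 Y Z) - split_F2 [X ,, Y] Z)
    + (der_b01 (split_F1 Y) (split_F2 Z X) - split_F2 [Y ,, Z] X)
    + (der_b01 (split_F1 Z) (split_F2 X Y) - split_F2 [Z ,, X] Y) =
  der_d2 (isotropy A) (split_F3 X Y Z).
Proof.
apply: der1_ext => [u|].
- (* The first two terms cancel in the cyclic sum; the bracketed ones add up to
     the left side of the cyclic coherence law. *)
  have summand (U V W : vfield M) :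
      ((der_b01 (split_F1 U) (split_F2 V W) - split_F2 [U ,, V] W).1 : Defs.hom G S1) u =
      l3 A (sg U) (sg [V ,, W]) (kv u) - l3 A (sg W) (sg [U ,, V]) (kv u)
      - (l21 A (sg U) (l3 A (sg V) (sg W) (kv u)) - l3 A (sg V) (sg W) (l20 A (sg U) (kv u))
         + l3 A (sg U) (l20 A (sg V) (sg W)) (kv u)).
    rewrite -[LHS]/(l21 A (sg U) (- l3 A (sg V) (sg W) (kv u))
      - - l3 A (sg V) (sg W) (l20 A (sg U) (kv u))
      + l3 A (sg U) (curvR_gamma s V W) (kv u) - - l3 A (sg [U ,, V]) (sg W) (kv u)).
    rewrite curvR_gammaE (l3_skew12 A (sg [U ,, V])) !(trilinE T3, rbilinE B1).
    by zmod.
  rewrite 2!pair1_addE !summand.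
  rewrite -[RHS]/(l21 A (kv u) (curvI_gamma s X Y Z)) curvI_gammaE (rbilinNr B1).
  have E := l3_coh_cyc A (sg X) (sg Y) (sg Z) (kv u).
  by zmodh E.
- apply: ker_ext.
  rewrite -[RHS]/(l1 A (curvI_gamma s X Y Z)) curvI_gammaE linearN /= l3_jacobi_cyc.
  rewrite -[LHS]/(l20 A (sg X) (curvR_gamma s Y Z) - curvR_gamma s [X ,, Y] Z
    + (l20 A (sg Y) (curvR_gamma s Z X) - curvR_gamma s [Y ,, Z] X)
    + (l20 A (sg Z) (curvR_gamma s X Y) - curvR_gamma s [Z ,, X] Y)).
  rewrite !curvR_gammaE !(rbilinE B0) !(law_skew2 L (sg [_ ,, _])).
  have bracket_cyc : sg [[X ,, Y] ,, Z] + sg [[Y ,, Z] ,, X] + sg [[Z ,, X] ,, Y] = 0.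
    rewrite -!linearD -[RHS](linear0 sg) /=; congr (sg _); apply: vf_ext => f.
    by rewrite -[RHS]/(0 : C) !vf_addE !bracketE !(vfD, vfN); zmod.
  by zmodh bracket_cyc.
Qed.

(** Grouping the six terms into the three pair partitions of the four vector
  fields turns them into the l3-terms of the coherence law. *)
Lemma split_eq4 (X1 X2 X3 X4 : vfield M) :
    let T Xi Xj Xk Xl := split_F3 [Xi ,, Xj] Xk Xl
      - @Cconst R n M 2^-1 *: der_b11 (split_F2 Xi Xj) (split_F2 Xk Xl) in
    der_b02 (split_F1 X1) (split_F3 X2 X3 X4) - der_b02 (split_F1 X2) (split_F3 X1 X3 X4)
    + der_b02 (split_F1 X3) (split_F3 X1 X2 X4) - der_b02 (split_F1 X4) (split_F3 X1 X2 X3)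
    + (- T X1 X2 X3 X4 + T X1 X3 X2 X4 - T X1 X4 X2 X3
       - T X2 X3 X1 X4 + T X2 X4 X1 X3 - T X3 X4 X1 X2) = 0.
Proof.
have half (m : S1) : @Cconst R n M 2^-1 *: (m + m) = m.
  rewrite -mulr2n -scaler_nat scalerA.
  suff -> : @Cconst R n M 2^-1 * 2%:R = 1 by rewrite scale1r.
  apply: val_inj; apply/funext => x.
  by rewrite -[LHS]/(2^-1 * 2%:R : R) mulVf ?Num.Theory.pnatr_eq0.
(* One pair partition {U V | W P}, with both orders of its blocks. *)
have partition_sum (U V W P : vfield M) :
    split_F3 [U ,, V] W P - @Cconst R n M 2^-1 *: der_b11 (split_F2 U V) (split_F2 W P)
    + (split_F3 [W ,, P] U V - @Cconst R n M 2^-1 *: der_b11 (split_F2 W P) (split_F2 U V)) =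
    - (l3 A (sg U) (sg V) (l20 A (sg W) (sg P))
       + l3 A (l20 A (sg U) (sg V)) (sg W) (sg P)).
  rewrite (der_b11_sym (split_F2 W P)) addrACA -opprD -scalerDr half.
  rewrite -[der_b11 _ _]/(- l3 A (sg U) (sg V) (curvR_gamma s W P)
    - l3 A (sg W) (sg P) (curvR_gamma s U V)).
  rewrite /split_F3 !curvI_gammaE !curvR_gammaE !(trilinE T3).
  rewrite !(l3_rot A (sg [_ ,, _])) !(l3_rot A (l20 A (sg U) (sg V))).
  by zmod.
move=> T.
have E := law_coh L (sg X1) (sg X2) (sg X3) (sg X4).
have E12 : T X1 X2 X3 X4 + T X3 X4 X1 X2 = _ := partition_sum X1 X2 X3 X4.
have E13 : T X1 X3 X2 X4 + T X2 X4 X1 X3 = _ := partition_sum X1 X3 X2 X4.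
have E14 : T X1 X4 X2 X3 + T X2 X3 X1 X4 = _ := partition_sum X1 X4 X2 X3.
rewrite /der_b02 -![cdo_app _ _]/(l21 A _ _) /split_F3 !curvI_gammaE !(rbilinE B1).
(* Move the inner brackets of the coherence law to the slots that the partition
   sums use. *)
rewrite (l3_skew12 A (sg X2) (l20 A _ _)) (l3_skew23 A (sg X1) (l20 A _ _)) in E.
rewrite -(l3_rot A (l20 A (sg X1) (sg X4))) in E.
have H := addE (addE (addE E E12) (esym E13)) E14.
by zmodh H.
Qed.

Definition splitting_morphism : lie3_morphism (tangent M) (DER (isotropy A)) :=
  @Lie3Morphism R n M (vfield M) (tangent M) _ _ _ (DER (isotropy A))
    split_F1 split_F2 split_F3 split_F2_bilin split_F2_skew split_F3_trilin
    split_F3_skew (sigmaK s) split_eq2 split_eq3 split_eq4.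

End SplittingMorphism.

Theorem theorem3p9 (R : realType) (n : nat) (M : smooth_manifold R n)
    (Am1 A0 : vector_bundle M) (A : lie2_algebroid Am1 A0)
    (trA : transitive_lie2 A) (s : splitting A) :
  exists F : lie3_morphism (tangent M) (DER (isotropy A)),
    [/\ forall (X : vfield M) (u : kermod (rho A)),
          ker_val (d_0 (F1 F X) u) = nabla0 s X (ker_val u),
        forall (X : vfield M) (m : section Am1),
          d_1 (F1 F X) m = nabla1 s X m
      & forall (X : vfield M) (u v : kermod (rho A)),
          d_l (F1 F X) u v = curvK s X (ker_val u) (ker_val v)] /\
    [/\ forall (X Y : vfield M) (u : kermod (rho A)),
          (F2 F X Y).1 u = curvJ s X Y (ker_val u),
        forall X Y : vfield M,
          ker_val (F2 F X Y).2 = curvR_gamma s X Y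
      & forall X Y Z : vfield M, F3 F X Y Z = curvI_gamma s X Y Z].
Proof.
exists (splitting_morphism s); split; split=> //.
Qed.
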